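(* Let $n,m\geq 1$ and let $u=(u^1,\dots,u^m):\mathbb{R}^n\to\mathbb{R}^m$ be a smooth map satisfying on all of $\mathbb{R}^n$ the self-shrinking system in Euclidean space $$\sum_{i,j=1}^n g^{ij}u^{\alpha}_{ij}=-u^{\alpha}+x\cdot Du^{\alpha},\qquad \alpha=1,\dots,m,$$ where $(g^{ij})$ is the inverse of $g_{ij}=\delta_{ij}+\sum_{\alpha=1}^m u^\alpha_i u^\alpha_j$. Suppose that one of the following three assumptions holds: (i) at every point of $\mathbb{R}^n$, the singular values $\lambda_i\geq 0$ of $du$ satisfy $\lambda_i\lambda_j\leq 1$ for any $i\neq j$; (ii) there is a positive constant $\beta<9$ such that $\det(g_{ij})\leq\beta$ on $\mathbb{R}^n$; (iii) at every point of $\mathbb{R}^n$, $\sum_{i,j}u^{\alpha}_{qi}g^{ij}u^{\beta}_{jp}=\sum_{i,j}u^{\beta}_{qi}g^{ij}u^{\alpha}_{jp}$ for all $\alpha,\beta\in\{1,\dots,m\}$ and all $p,q\in\{1,\dots,n\}$. Then the graph $M=\{(x,u(x)):x\in\mathbb{R}^n\}$ is a linear subspace of $\mathbb{R}^{n+m}$.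
   Context: Notation: $u^\alpha_i=\partial u^\alpha/\partial x_i$, $u^\alpha_{ij}=\partial^2u^\alpha/\partial x_i\partial x_j$, $Du^\alpha=(u^\alpha_1,\dots,u^\alpha_n)$, $\cdot$ is the standard inner product on $\mathbb{R}^n$. The singular values of $du$ at a point are the singular values (with multiplicity) of the $m\times n$ matrix $(u^\alpha_i)$; indices $i$ beyond $\min\{m,n\}$ have $\lambda_i=0$. The system says that $M$ is a self-shrinker ($H=-X^N$) in Euclidean space. *)

(* Defs.v *)
From HB Require Import structures.
From mathcomp Require Import all_boot all_order all_algebra.
From mathcomp Require Import all_classical all_reals all_analysis.
Set Implicit Arguments.
Unset Strict Implicit.
Unset Printing Implicit Defensive.
Import Order.TTheory GRing.Theory Num.Theory.
Import numFieldNormedType.Exports.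
Local Open Scope classical_set_scope.
Local Open Scope ring_scope.

Section PartialDerivatives.
Context {R : realType} {n m : nat}.

Definition basis_vec (i : 'I_n) : 'rV[R]_n := delta_mx 0 i.

Definition partial (i : 'I_n) (f : 'rV[R]_n -> R) : 'rV[R]_n -> R :=
  fun x => 'D_(basis_vec i) f x.

(* C^k: all iterated partial derivatives of order at most k exist everywhere
   and are continuous.  The derivability clause is needed because 'D_v f x is
   a total operator. *)
Fixpoint Ck (k : nat) (f : 'rV[R]_n -> R) : Prop :=
  continuous f /\
  (if k is k'.+1 then
     forall i : 'I_n,
       (forall x, derivable f x (basis_vec i)) /\ Ck k' (partial i f)
   else True).

Definition component (u : 'rV[R]_n -> 'rV[R]_m) (a : 'I_m) : 'rV[R]_n -> R :=
  fun x => u x 0 a.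

Definition smooth_map (u : 'rV[R]_n -> 'rV[R]_m) : Prop :=
  forall (k : nat) (a : 'I_m), Ck k (component u a).

Definition d1 (u : 'rV[R]_n -> 'rV[R]_m) (a : 'I_m) (i : 'I_n) (x : 'rV[R]_n) : R :=
  partial i (component u a) x.

Definition d2 (u : 'rV[R]_n -> 'rV[R]_m) (a : 'I_m) (i j : 'I_n) (x : 'rV[R]_n) : R :=
  partial i (partial j (component u a)) x.

(* The m x n matrix (u^a_i), acting on column vectors; the library's jacobian
   'J u x is its transpose. *)
Definition diff_mx (u : 'rV[R]_n -> 'rV[R]_m) (x : 'rV[R]_n) : 'M[R]_(m, n) :=
  \matrix_(a, i) d1 u a i x.

Definition metric (u : 'rV[R]_n -> 'rV[R]_m) (x : 'rV[R]_n) : 'M[R]_n :=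
  \matrix_(i, j) ((i == j)%:R + \sum_(a < m) d1 u a i x * d1 u a j x).

(* The metric is positive definite, so invmx is its genuine inverse. *)
Definition inv_metric (u : 'rV[R]_n -> 'rV[R]_m) (x : 'rV[R]_n) : 'M[R]_n :=
  invmx (metric u x).

Definition self_shrinking_system (u : 'rV[R]_n -> 'rV[R]_m) : Prop :=
  forall (x : 'rV[R]_n) (a : 'I_m),
    \sum_(i < n) \sum_(j < n) inv_metric u x i j * d2 u a i j x
    = - u x 0 a + \sum_(i < n) x 0 i * d1 u a i x.

Definition graph_of (u : 'rV[R]_n -> 'rV[R]_m) : set 'rV[R]_(n + m) :=
  range (fun x : 'rV[R]_n => row_mx x (u x)).

End PartialDerivatives.

(* lam lists, in some order and with multiplicity, the square roots of the n
   eigenvalues of A^T A, i.e. the singular values of the m x n matrix A padded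
   with zeros when m < n.  Such a lam exists and is unique up to permutation. *)
Definition singular_values {R : realType} {m n : nat}
    (A : 'M[R]_(m, n)) (lam : 'I_n -> R) : Prop :=
  (forall i, 0 <= lam i) /\
  char_poly (A^T *m A) = \prod_(i < n) ('X - (lam i ^+ 2)%:P).

(* Main.v *)
(* In the coordinates x of the base, the drift Laplacian Delta - <X, grad> of the
   graph is L = sum g^{ij} d_i d_j - x . D, and L|x|^2 <= 2n - 2|x|^2.  Hence a
   function w that is bounded below with L w <= 0 attains its minimum, and Hopf's
   argument makes it constant; no volume growth or integral estimate is needed.

   Differentiating the system gives, for f = ln (det g) and a frame adapted to the
   singular values lam_i of du,
     L f = 2 (|A|^2 + sum lam_i lam_j h_{i,jk} h_{j,ik}),
     |grad f|^2 = 4 sum_k (sum_i lam_i h_{i,ik})^2,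
   where h are the components of the second fundamental form A.  Under (i) and
   (iii) the function (det g)^(-1/(2n)), and under (ii) the function - det g, is
   L-superharmonic, and L annihilates it only where A = 0.  So A vanishes, u is
   affine, and the system makes it linear. *)

Require Import Defs.
From HB Require Import structures.
From mathcomp Require Import all_boot all_order all_algebra.
From mathcomp Require Import all_classical all_reals all_analysis.
From mathcomp Require Import ring lra.
Set Implicit Arguments.
Unset Strict Implicit.
Unset Printing Implicit Defensive.
Import Order.TTheory GRing.Theory Num.Theory.
Import numFieldNormedType.Exports.
Local Open Scope classical_set_scope.
Local Open Scope ring_scope.

(** * Third-order tensors *)

(** The exponents come from one identity: for w = (det g)^k, L w = 2k w (|A|^2 + sum lam_i lam_j
    h_{i,jk} h_{j,ik} + 2k sum_k (sum_i lam_i h_{i,ik})^2). So k must make the bracket nonnegative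
    while w or -w, according to the sign of k, is bounded below. For k = -1/(2n) the last
    coefficient is -1/n, which is what Cauchy-Schwarz lets the terms i = j of the cross sum absorb.
    Under (ii) the first two terms alone can be negative; k = 1 adds twice the trace square, and the
    upper bound on det g becomes the lower bound on -det g. The constant 9 is (1 + 2)(1 + 2): with
    two singular values equal to sqrt 2 the form in the entries with three distinct indices
    degenerates. The obstacle is that h_{i,jk} is symmetric only in j and k: i is a normal index,
    matched with a tangent index only through the singular vectors. Unmatched normal directions
    enter |A|^2 but neither of the other two terms, so the algebra concerns the matched part, and
    the rest of A is recovered at the end. *)

Lemma sumr_sqr_le (R : realFieldType) (I : finType) (P : pred I) (a b : I -> R) :
  (\sum_(i | P i) a i * b i) ^+ 2
    <= (\sum_(i | P i) a i ^+ 2) * (\sum_(i | P i) b i ^+ 2).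
Proof.
have : 0 <= \sum_(i | P i) \sum_(j | P j) (a i * b j - a j * b i) ^+ 2.
  by apply: sumr_ge0 => i _; apply: sumr_ge0 => j _; exact: sqr_ge0.
have -> : \sum_(i | P i) \sum_(j | P j) (a i * b j - a j * b i) ^+ 2
  = \sum_(i | P i) \sum_(j | P j) (a i ^+ 2 * b j ^+ 2 + b i ^+ 2 * a j ^+ 2
       - 2 * (a i * b i * (a j * b j))).
  by apply: eq_bigr => i _; apply: eq_bigr => j _; ring.
under eq_bigr do rewrite sumrB big_split /= -!mulr_sumr.
rewrite sumrB big_split /= -!mulr_suml -!mulr_sumr -!mulr_suml; lra.
Qed.

Lemma sum3_eq0 (R : realFieldType) (I J K : finType) (F : I -> J -> K -> R) :
  (forall i j k, 0 <= F i j k) -> \sum_i \sum_j \sum_k F i j k <= 0 ->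
  forall i j k, F i j k = 0.
Proof.
move=> F0 Fle i j k.
have S1 a b : 0 <= \sum_c F a b c by apply: sumr_ge0.
have S2 a : 0 <= \sum_b \sum_c F a b c by apply: sumr_ge0.
have /eqP : \sum_a \sum_b \sum_c F a b c = 0.
  by apply/eqP; rewrite eq_le Fle sumr_ge0.
rewrite psumr_eq0// => /allP/(_ i (mem_index_enum _)) /=.
rewrite psumr_eq0// => /allP/(_ j (mem_index_enum _)) /=.
by rewrite psumr_eq0// => /allP/(_ k (mem_index_enum _)) /= /eqP.
Qed.

Section ThirdOrderTensor.
Context {R : realFieldType} {n : nat}.
Implicit Types (lam : 'I_n -> R) (h : 'I_n -> 'I_n -> 'I_n -> R).

Definition sqnorm3 h : R := \sum_i \sum_j \sum_k h i j k ^+ 2.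

Definition cross3 lam h : R :=
  \sum_i \sum_j \sum_k lam i * lam j * (h i j k * h j i k).

Definition trace3 lam h : R := \sum_k (\sum_i lam i * h i i k) ^+ 2.

Lemma sqnorm3_ge0 h : 0 <= sqnorm3 h.
Proof. by do 3!(apply: sumr_ge0 => ? _); exact: sqr_ge0. Qed.

Lemma trace3_ge0 lam h : 0 <= trace3 lam h.
Proof. by apply: sumr_ge0 => ? _; exact: sqr_ge0. Qed.

Lemma sqnorm3_eq0 h : sqnorm3 h <= 0 -> forall i j k, h i j k = 0.
Proof.
move=> h0 i j k.
have /(_ i j k)/eqP := sum3_eq0 (fun i j k => sqr_ge0 (h i j k)) h0.
by rewrite sqrf_eq0 => /eqP.
Qed.

(** Alternating the two exchanges six times returns to the same entry after three sign changes. *)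
Lemma antisym_sym_eq0 h :
  (forall i j k, h i j k = h i k j) -> (forall i j k, h i j k = - h j i k) ->
  forall i j k, h i j k = 0.
Proof.
move=> hs ha i j k; have := ha i j k; have := ha j k i; have := ha k i j.
by rewrite (hs j k i) (hs k j i) (hs i k j); lra.
Qed.

Section Contracting.
Variables (lam : 'I_n -> R) (h : 'I_n -> 'I_n -> 'I_n -> R).
Hypothesis hsym : forall i j k, h i j k = h i k j.
Hypothesis lam_ge0 : forall i, 0 <= lam i.
Hypothesis lam_le1 : forall i j, i != j -> lam i * lam j <= 1.

(** By Cauchy-Schwarz, n^-1 times the trace term is at most the sum of [(lam i * h i i k) ^+ 2],
    which lives on i = j and cancels the cross term there exactly. The rest is grouped as
    [c i j k + c j i k], since the cross term couples [h i j k] with [h j i k]. *)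
Let c i j k : R := h i j k ^+ 2 + lam i * lam j * (h i j k * h j i k)
  - (i == j)%:R * (lam i * h i j k) ^+ 2.

Let contracting_ge : \sum_i \sum_j \sum_k (c i j k + c j i k)
  <= 2 * (sqnorm3 h + cross3 lam h - n%:R^-1 * trace3 lam h).
Proof.
have -> : \sum_i \sum_j \sum_k (c i j k + c j i k)
    = 2 * \sum_i \sum_j \sum_k c i j k.
  under eq_bigr do under eq_bigr do rewrite big_split /=.
  under eq_bigr do rewrite big_split /=.
  by rewrite big_split /= [X in _ + X]exchange_big /= mulr_natl.
rewrite ler_pM2l//.
have -> : \sum_i \sum_j \sum_k c i j k = sqnorm3 h + cross3 lam h
   - \sum_i \sum_k (lam i * h i i k) ^+ 2.
  under eq_bigr do under eq_bigr do rewrite sumrB big_split /=.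
  under eq_bigr do rewrite sumrB big_split /=.
  rewrite sumrB big_split /=; congr (_ - _); apply: eq_bigr => i _.
  rewrite (bigD1 i)//= [X in _ + X]big1 ?addr0.
    by under eq_bigr do rewrite eqxx mul1r.
  move=> j ji; rewrite big1// => k _.
  by rewrite eq_sym (negbTE ji) mul0r.
rewrite lerD2l lerN2 exchange_big /= mulr_sumr; apply: ler_sum => k _.
have [n0|n0] := eqVneq n 0%N.
  by rewrite [in n%:R]n0 invr0 mul0r sumr_ge0// => i _; exact: sqr_ge0.
rewrite ler_pdivrMl ?ltr0n ?lt0n//.
have := sumr_sqr_le predT (fun=> 1) (fun i => lam i * h i i k); rewrite /=.
under eq_bigr do rewrite mul1r.
by under [X in _ <= X * _]eq_bigr do rewrite expr1n; rewrite sumr_const card_ord.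
Qed.

Let c_diag i k : c i i k + c i i k = 2 * h i i k ^+ 2.
Proof. by rewrite /c eqxx mul1r; ring. Qed.

Let c_pair i j k : i != j -> c i j k + c j i k =
  (1 - lam i * lam j) * (h i j k ^+ 2 + h j i k ^+ 2)
   + lam i * lam j * (h i j k + h j i k) ^+ 2.
Proof. by move=> ij; rewrite /c (eq_sym j i) (negbTE ij) !mul0r; ring. Qed.

Let c_ge0 i j k : 0 <= c i j k + c j i k.
Proof.
have [<-|ij] := eqVneq i j.
  by rewrite c_diag mulr_ge0 ?sqr_ge0.
have p0 := mulr_ge0 (lam_ge0 i) (lam_ge0 j); have p1 := lam_le1 ij.
rewrite c_pair//; apply: addr_ge0; apply: mulr_ge0 => //.
- by rewrite subr_ge0.
- by rewrite addr_ge0 ?sqr_ge0.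
- exact: sqr_ge0.
Qed.

Lemma contracting_tensor_ge0 :
  0 <= sqnorm3 h + cross3 lam h - n%:R^-1 * trace3 lam h.
Proof.
rewrite -(pmulr_rge0 _ (ltr0n _ 2)); apply: le_trans contracting_ge.
by do 3!(apply: sumr_ge0 => ? _).
Qed.

(** Where [lam i * lam j] equals 1, only the square of [h i j k + h j i k] survives, so vanishing
    yields no more than antisymmetry in the first two indices. Together with the symmetry in the
    last two this is still enough. *)
Lemma contracting_tensor_eq0 :
  sqnorm3 h + cross3 lam h - n%:R^-1 * trace3 lam h <= 0 ->
  forall i j k, h i j k = 0.
Proof.
move=> Q0; apply: antisym_sym_eq0 => // i j k.
have /(_ i j k) : forall i j k, c i j k + c j i k = 0.
  by apply: sum3_eq0 => //; apply: le_trans contracting_ge _; lra.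
have [<-|ij] := eqVneq i j.
  by move=> /eqP; rewrite c_diag mulf_eq0 pnatr_eq0 /= sqrf_eq0 => /eqP ->; rewrite oppr0.
rewrite c_pair// => /eqP.
have := lam_le1 ij; rewrite le_eqVlt => /orP[/eqP->|lt1].
  by rewrite subrr mul0r add0r mul1r sqrf_eq0 addr_eq0 => /eqP.
have p0 := mulr_ge0 (lam_ge0 i) (lam_ge0 j).
have S0 : 0 <= h i j k ^+ 2 + h j i k ^+ 2 by rewrite addr_ge0 ?sqr_ge0.
rewrite paddr_eq0; first last.
- by apply: mulr_ge0 => //; exact: sqr_ge0.
- by apply: mulr_ge0 => //; rewrite subr_ge0 ltW.
rewrite mulf_eq0 subr_eq0 gt_eqF//= paddr_eq0 ?sqr_ge0// !sqrf_eq0.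
by move=> /andP[/andP[/eqP-> /eqP->] _]; rewrite oppr0.
Qed.

End Contracting.

(** The terms with a repeated index are collected by k because the k-th summand of [trace3] involves
    only the entries [h i i k]; each k then gives a separate quadratic form, the one of
    [row_form_ge0]. The entry with all indices equal is counted once, in the first inner sum. *)
Lemma sum3_diagonals (q : 'I_n -> 'I_n -> 'I_n -> R) :
  \sum_i \sum_j \sum_k q i j k
  = \sum_i \sum_j \sum_k [&& i != j, j != k & i != k]%:R * q i j k
    + \sum_k (\sum_i q i i k + \sum_(i | i != k) (q k i i + q i k i)).
Proof.
have delta j (f : 'I_n -> R) : \sum_k (j == k)%:R * f k = f j.
  rewrite (bigD1 j)//= eqxx mul1r big1 ?addr0// => k kj.
  by rewrite eq_sym (negbTE kj) mul0r.
have ind (P : pred 'I_n) (f : 'I_n -> R) :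
    \sum_(i | P i) f i = \sum_i (P i)%:R * f i.
  rewrite big_mkcond; apply: eq_bigr => i _; by case: (P i); rewrite ?mul1r ?mul0r.
have -> : \sum_k (\sum_i q i i k + \sum_(i | i != k) (q k i i + q i k i)) =
   \sum_i \sum_j \sum_k (i == j)%:R * q i j k
   + \sum_i \sum_j \sum_k (j == k)%:R * ((i != j)%:R * q i j k)
   + \sum_i \sum_j \sum_k (i == k)%:R * ((i != j)%:R * q i j k).
  rewrite big_split /= -addrA; congr (_ + _).
    rewrite exchange_big /=; apply: eq_bigr => i _.
    by rewrite exchange_big /=; apply: eq_bigr => k _; rewrite delta.
  under eq_bigr do rewrite big_split /=.
  rewrite big_split /=; congr (_ + _).
    apply: eq_bigr => i _; rewrite ind; apply: eq_bigr => j _.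
    by rewrite delta eq_sym.
  under eq_bigr do rewrite ind.
  rewrite exchange_big /=; apply: eq_bigr => i _; apply: eq_bigr => j _.
  by rewrite delta.
rewrite -!big_split /=; apply: eq_bigr => i _.
rewrite -!big_split /=; apply: eq_bigr => j _.
rewrite -!big_split /=; apply: eq_bigr => k _.
have [<-|ij] := eqVneq i j; first by rewrite /= !mul1r !mul0r; ring.
have [<-|jk] := eqVneq j k.
  by rewrite (negbTE ij) /=; ring.
by have [<-|ik] := eqVneq i k => /=; ring.
Qed.

Lemma sum3_cycle (t : 'I_n -> 'I_n -> 'I_n -> R) :
  \sum_i \sum_j \sum_k (t i j k + t j k i + t k i j)
    = 3 * \sum_i \sum_j \sum_k t i j k.
Proof.
under eq_bigr do under eq_bigr do rewrite !big_split /=.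
under eq_bigr do rewrite !big_split /=.
rewrite !big_split /=.
have -> : \sum_i \sum_j \sum_k t j k i = \sum_i \sum_j \sum_k t i j k.
  rewrite exchange_big /=; apply: eq_bigr => j _.
  by rewrite exchange_big.
have -> : \sum_i \sum_j \sum_k t k i j = \sum_i \sum_j \sum_k t i j k.
  under eq_bigr do rewrite exchange_big /=.
  by rewrite exchange_big.
by ring.
Qed.

End ThirdOrderTensor.

(** * Quadratic forms under the bound 9 on the determinant *)

Lemma binary_form_ge0 (R : realFieldType) (A B C b c : R) :
  0 <= A -> 0 <= C -> B ^+ 2 <= 4 * A * C ->
  0 <= A * b ^+ 2 + B * (b * c) + C * c ^+ 2.
Proof.
move=> A0 C0 disc; have [A_0|An0] := eqVneq A 0.
  have : B ^+ 2 <= 0 by move: disc; rewrite A_0 mulr0 mul0r.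
  rewrite real_exprn_even_le0 ?num_real//= => /eqP->.
  by rewrite A_0 !mul0r !add0r mulr_ge0 ?sqr_ge0.
have Ap : 0 < A by rewrite lt_neqAle eq_sym An0.
rewrite -(pmulr_rge0 _ (_ : 0 < 4 * A)) ?mulr_gt0//.
have -> : 4 * A * (A * b ^+ 2 + B * (b * c) + C * c ^+ 2) =
  (2 * A * b + B * c) ^+ 2 + (4 * A * C - B ^+ 2) * c ^+ 2 by ring.
apply: addr_ge0; first exact: sqr_ge0.
by apply: mulr_ge0; [rewrite subr_ge0|exact: sqr_ge0].
Qed.

(** For x, y, z the squares of u, v, w, this is nonnegativity of the determinant of the form in
    [ternary_form_ge0], up to a factor 4. Equality holds at (2, 2, 0), where the product is exactly
    9. In elementary symmetric functions, a failure would give 3 < s1 < 4, and Schur's inequality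
    excludes that range. *)
Lemma ternary_det_ge0 (R : realFieldType) (x y z : R) :
  0 <= x -> 0 <= y -> 0 <= z -> (1 + x) * (1 + y) * (1 + z) <= 9 ->
  x * y + y * z + z * x <= 4 + x * y * z.
Proof.
move=> x0 y0 z0 le9; rewrite leNgt; apply/negP => gt4.
set s1 := x + y + z; set s2 := x * y + y * z + z * x; set s3 := x * y * z.
have h9 : s1 + s2 + s3 <= 8 by rewrite /s1 /s2 /s3; lra.
have s30 : 0 <= s3 by rewrite /s3 !mulr_ge0.
have s2gt : 4 + s3 < s2 by [].
have s1lt : s1 < 4 - 2 * s3 by lra.
have s1ge0 : 0 <= s1 by rewrite /s1 !addr_ge0.
have s2le : 3 * s2 <= s1 ^+ 2.
  rewrite -subr_ge0 (_ : _ - _ =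
    ((x - y) ^+ 2 + (y - z) ^+ 2 + (z - x) ^+ 2) / 2).
    by rewrite divr_ge0 ?addr_ge0 ?sqr_ge0.
  by rewrite /s1 /s2; field.
have s1gt : 3 < s1.
  rewrite ltNge; apply/negP => s1le; have : s1 ^+ 2 <= 3 ^+ 2 by rewrite lerXn2r ?nnegrE.
  lra.
(* Schur's inequality of degree one. It is symmetric, so x <= y may be assumed, and the position of
   z decides how the sum is split into nonnegative products. *)
have schur : 4 * s1 * s2 <= s1 ^+ 3 + 9 * s3.
  rewrite -subr_ge0 (_ : _ - _ = x * (x - y) * (x - z) + y * (y - z) * (y - x)
     + z * (z - x) * (z - y)); last by rewrite /s1 /s2 /s3; ring.
  clear -x0 y0 z0.
  wlog xy : x y x0 y0 / x <= y => [H|].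
    have [xy|/ltW xy] := leP x y; first exact: H.
    rewrite (_ : _ + _ = y * (y - x) * (y - z) + x * (x - z) * (x - y)
      + z * (z - y) * (z - x)); [exact: H|ring].
  have [yz|/ltW zy] := leP y z.
    rewrite (_ : _ + _ = x * ((y - x) * (z - x))
      + (z - y) * ((z - y) * (z + y - x))); last by ring.
    by apply: addr_ge0; repeat (apply: mulr_ge0); lra.
  have [xz|/ltW zx] := leP x z.
    rewrite (_ : _ + _ = z * ((z - x) * (y - z))*0 + (x * (y - x) * (z - x) +
       ((y - z) * ((y - z) * (y + z - x))))); last by ring.
    rewrite mulr0 add0r.
    by apply: addr_ge0; repeat (apply: mulr_ge0); lra.
  rewrite (_ : _ + _ = z * ((x - z) * (y - z))
      + (y - x) * ((y - x) * (y + x - z))); last by ring.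
  by apply: addr_ge0; repeat (apply: mulr_ge0); lra.
have : 4 * s1 * (4 + s3) < s1 ^+ 3 + 9 * s3.
  apply: lt_le_trans schur; rewrite ltr_pM2l//; lra.
have : s1 * s1 ^+ 2 <= s1 * 4 ^+ 2.
  by rewrite ler_pM2l ?lerXn2r ?nnegrE//; lra.
have : 12 * s3 <= 4 * s1 * s3.
  by rewrite ler_wpM2r//; lra.
rewrite -exprS; lra.
Qed.

(** Completing the square in a leaves a binary form in b and c, whose discriminant condition follows
    from [ternary_det_ge0]. *)
Lemma ternary_form_ge0 (R : realFieldType) (u v w a b c : R) :
  0 <= u -> 0 <= v -> 0 <= w ->
  (1 + u ^+ 2) * (1 + v ^+ 2) * (1 + w ^+ 2) <= 9 ->
  0 <= a ^+ 2 + b ^+ 2 + c ^+ 2 + u * v * (a * b) + v * w * (b * c)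
         + w * u * (c * a).
Proof.
move=> u0 v0 w0 le9.
(* Since (1 + xy)^2 <= (1 + x^2)(1 + y^2) <= 9, the product xy is at most 2; this makes the two
   diagonal coefficients of the binary form nonnegative. *)
have pair (x y z : R) : 0 <= x -> 0 <= y ->
    (1 + x ^+ 2) * (1 + y ^+ 2) * (1 + z ^+ 2) <= 9 -> (x * y) ^+ 2 <= 2 ^+ 2.
  move=> x0 y0 H; rewrite lerXn2r ?nnegrE ?mulr_ge0// leNgt; apply/negP => xy2.
  have x2 := sqr_ge0 x; have y2 := sqr_ge0 y; have z2 := sqr_ge0 z.
  have : (1 + x ^+ 2) * (1 + y ^+ 2) <= 9.
    apply: le_trans H; rewrite ler_peMr ?mulr_ge0; lra.
  have : 0 < (x * y - 2) * (x * y + 4) by rewrite mulr_gt0; lra.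
  have := sqr_ge0 (x - y); lra.
have uv := pair _ _ _ u0 v0 le9.
have wu : (w * u) ^+ 2 <= 2 ^+ 2 by apply: (pair _ _ v) => //; lra.
have := ternary_det_ge0 (sqr_ge0 u) (sqr_ge0 v) (sqr_ge0 w) le9 => det.
rewrite (_ : _ + _ = (a + (u * v * b + w * u * c) / 2) ^+ 2 +
  ((1 - (u * v) ^+ 2 / 4) * b ^+ 2 + (v * w - (u * v) * (w * u) / 2) * (b * c)
   + (1 - (w * u) ^+ 2 / 4) * c ^+ 2)); last by field.
apply: addr_ge0; first exact: sqr_ge0.
by apply: binary_form_ge0; lra.
Qed.

Lemma prod_1D_ge (R : realFieldType) (I : finType) (P : pred I) (x : I -> R) :
  (forall i, 0 <= x i) -> 1 + \sum_(i | P i) x i <= \prod_(i | P i) (1 + x i).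
Proof.
move=> x0.
suff [] : 1 + \sum_(i | P i) x i <= \prod_(i | P i) (1 + x i)
          /\ 0 <= \sum_(i | P i) x i by [].
elim/big_rec2 : _ => [|i s p _ [sp s0]]; first by rewrite addr0.
split; last by rewrite addr_ge0.
have := x0 i => xi0.
have : (1 + x i) * (1 + s) <= (1 + x i) * p.
  by rewrite ler_wpM2l// addr_ge0.
by have := mulr_ge0 xi0 s0; lra.
Qed.

Section SmallProduct.
Context {R : realFieldType} {n : nat}.
Variables (lam : 'I_n -> R).
Hypothesis lam_ge0 : forall i, 0 <= lam i.
Hypothesis prod_le9 : \prod_i (1 + lam i ^+ 2) <= 9.

Let sq_ge0 i : 0 <= lam i ^+ 2. Proof. exact: sqr_ge0. Qed.

(* Completing the square in z i leaves the coefficient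
   a i = 2 + lam i ^+ 2 - lam i ^+ 2 * lam k ^+ 2 on y i ^+ 2.  If a j < 0, then
   (1 + lam j ^+ 2) * (1 + lam k ^+ 2) > 8, so the other lam i are tiny and all the
   other coefficients are large enough for the last square to absorb a j. *)
Lemma row_form_ge0 (k : 'I_n) (y z : 'I_n -> R) :
  0 <= \sum_i (1 + lam i ^+ 2) * y i ^+ 2
    + \sum_(i | i != k) (z i ^+ 2 + y i ^+ 2 + 2 * lam i * lam k * (y i * z i))
    + 2 * (\sum_i lam i * y i) ^+ 2.
Proof.
pose a i := 2 + lam i ^+ 2 - lam i ^+ 2 * lam k ^+ 2.
have : (1 + lam k ^+ 2) * y k ^+ 2 + \sum_(i | i != k) a i * y i ^+ 2 <=
    \sum_i (1 + lam i ^+ 2) * y i ^+ 2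
    + \sum_(i | i != k) (z i ^+ 2 + y i ^+ 2 + 2 * lam i * lam k * (y i * z i)).
  rewrite [in leRHS](bigD1 k)//= -addrA lerD2l -big_split /=.
  apply: ler_sum => i _; rewrite -subr_ge0 /a.
  rewrite (_ : _ - _ = (z i + lam i * lam k * y i) ^+ 2); last by ring.
  exact: sqr_ge0.
suff : 0 <= (1 + lam k ^+ 2) * y k ^+ 2 + \sum_(i | i != k) a i * y i ^+ 2
    + 2 * (\sum_i lam i * y i) ^+ 2 by lra.
have yk0 : 0 <= (1 + lam k ^+ 2) * y k ^+ 2.
  by rewrite mulr_ge0 ?sqr_ge0// addr_ge0.
have [/forall_inP a0|] := boolP [forall (i | i != k), 0 <= a i].
  apply: addr_ge0; last by rewrite mulr_ge0 ?sqr_ge0.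
  apply: addr_ge0 => //; apply: sumr_ge0 => i ik.
  by rewrite mulr_ge0 ?sqr_ge0 ?a0.
rewrite negb_forall_in => /exists_inP[j jk]; rewrite -ltNge => aj.
have := prod_le9; rewrite (bigD1 k)//= (bigD1 j)//=.
have := prod_1D_ge [pred i | (i != k) && (i != j)] sq_ge0.
rewrite [in X in X -> _]/=; set S := \sum_(_ | _) _.
set Pi := \prod_(_ | _) _ => SPi Pi9.
rewrite (bigD1 j)//= [\sum_(i < n) lam i * y i](bigD1 k)//=.
rewrite [\sum_(i < n | i != k) lam i * y i](bigD1 j)//=.
set t := \sum_(i | _) lam i * y i; set s := \sum_(i | _) a i * y i ^+ 2.
have S0 : 0 <= S by exact: sumr_ge0.
have [x0 w0] := (sq_ge0 j, sq_ge0 k).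
have : 2 + lam j ^+ 2 - lam j ^+ 2 * lam k ^+ 2 < 0 by [].
set x := lam j ^+ 2; set w := lam k ^+ 2 => axw.
rewrite -/x in x0 Pi9; rewrite -/w in w0 Pi9.
have S9 : (1 + w) * (1 + x) * (1 + S) <= 9.
  apply: le_trans Pi9; rewrite -mulrA; apply: ler_wpM2l; first lra.
  by apply: ler_wpM2l => [|//]; rewrite addr_ge0.
have xw9 : (1 + w) * (1 + x) <= 9.
  apply: le_trans S9; rewrite ler_peMr//; last lra.
  by apply: mulr_ge0; lra.
have xw2 : 2 < x * (w - 1) by lra.
have w1 : 1 < w.
  rewrite ltNge; apply/negP => w1.
  have : 0 <= x * (1 - w) by rewrite mulr_ge0 ?subr_ge0.
  lra.
(* Inserting x > 2 / (w - 1) into (1 + w)(1 + x) <= 9 gives (w - 2)(w - 5) < 0. *)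
have w5 : w <= 5.
  rewrite leNgt; apply/negP => w5.
  have : 0 < (w - 2) * (w - 5) by rewrite mulr_gt0; lra.
  have : 0 <= (9 - (1 + w) * (1 + x)) * (w - 1) by rewrite mulr_ge0; lra.
  have : 0 <= (x * (w - 1) - 2) * (1 + w) by rewrite mulr_ge0; lra.
  lra.
(* The same bound on x gives (1 + w)(1 + x) >= (1 + w)^2 / (w - 1) >= 8, the last step being (w -
   3)^2 >= 0; so 1 + S is at most 9/8. *)
have S8 : S <= 1 / 8.
  rewrite leNgt; apply/negP => S8.
  have xw8 : 8 <= (1 + w) * (1 + x).
    rewrite -subr_ge0 -(pmulr_lge0 _ (_ : 0 < w - 1)); last lra.
    have : 0 <= (x * (w - 1) - 2) * (1 + w) by rewrite mulr_ge0; lra.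
    have := sqr_ge0 (w - 3); lra.
  have : 8 * (9 / 8) < (1 + w) * (1 + x) * (1 + S).
    apply: le_lt_trans (_ : (1 + w) * (1 + x) * (9 / 8) < _).
      by apply: ler_wpM2r => //; lra.
    by rewrite ltr_pM2l; lra.
  lra.
(* This says [a j >= - (2 / 3) * x], the deficit that the final square can absorb. Otherwise -8/3
   x^2 + 13/3 x - 2 would be positive, but its maximum, at x = 13/16, is negative. *)
have xw : x * w <= 2 + 5 / 3 * x.
  rewrite leNgt; apply/negP => xw.
  have : 0 <= x * (6 - 8 / 3 * x - w) by rewrite mulr_ge0; lra.
  have := sqr_ge0 (x - 13 / 16); lra.
have sge : 3 / 2 * \sum_(i | (i != k) && (i != j)) y i ^+ 2 <= s.
  rewrite mulr_sumr; apply: ler_sum => i iP.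
  apply: ler_wpM2r; first exact: sqr_ge0.
  have xi : lam i ^+ 2 <= S by rewrite /S (bigD1 i)//= lerDl sumr_ge0.
  have : lam i ^+ 2 * (w - 1) <= 1 / 8 * 4 by rewrite ler_pM ?sq_ge0; lra.
  rewrite /a -/w; lra.
have tle : t ^+ 2 <= 1 / 8 * \sum_(i | (i != k) && (i != j)) y i ^+ 2.
  apply: le_trans (sumr_sqr_le _ _ _) _.
  apply: ler_wpM2r => //; by apply: sumr_ge0 => i _; exact: sqr_ge0.
have t6 : 6 * t ^+ 2 <= s by have := sqr_ge0 t; lra.
have p65 : 6 / 5 * (lam k * y k) ^+ 2 <= (1 + w) * y k ^+ 2.
  rewrite exprMn mulrA; apply: ler_wpM2r; first exact: sqr_ge0.
  rewrite -/w; lra.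
have Y0 : 0 <= (a j + 2 / 3 * x) * y j ^+ 2.
  by rewrite mulr_ge0 ?sqr_ge0// /a -/x -/w; lra.
have Yx : (lam j * y j) ^+ 2 = x * y j ^+ 2 by rewrite exprMn.
rewrite -/(a j).
set p := lam k * y k in p65 *; set Y := lam j * y j in Yx *.
(* The constants 6, 6/5 and 2/3 fit the identity 6/5 p^2 + 6 t^2 - 2/3 Y^2 + 2 (p + Y + t)^2 = (p -
   5t)^2 / 5 + (3 (p + t) + 2Y)^2 / 3. *)
have := sqr_ge0 (p - 5 * t); have := sqr_ge0 (3 * (p + t) + 2 * Y).
lra.
Qed.

(** The trace term is spent entirely on the entries with a repeated index. For distinct i, j, k the
    cyclic sum involves only [h i j k], [h j k i] and [h k i j], and is the ternary form with
    coefficients lam i, lam j, lam k. *)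
Lemma small_product_tensor_ge0 (h : 'I_n -> 'I_n -> 'I_n -> R) :
  (forall i j k, h i j k = h i k j) ->
  0 <= sqnorm3 h + cross3 lam h + 2 * trace3 lam h.
Proof.
move=> hs; pose q i j k := h i j k ^+ 2 + lam i * lam j * (h i j k * h j i k).
have -> : sqnorm3 h + cross3 lam h = \sum_i \sum_j \sum_k q i j k.
  rewrite -big_split; apply: eq_bigr => i _; rewrite -big_split.
  by apply: eq_bigr => j _; rewrite -big_split.
rewrite sum3_diagonals -addrA addr_ge0//; last first.
  rewrite /trace3 mulr_sumr -big_split /=; apply: sumr_ge0 => k _.
  have := row_form_ge0 k (fun i => h i i k) (fun i => h k i i).
  congr (0 <= _ + _ + _).
    by apply: eq_bigr => i _; rewrite /q; ring.
  by apply: eq_bigr => i _; rewrite /q (hs i k i); ring.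
pose t i j k := [&& i != j, j != k & i != k]%:R * q i j k.
rewrite -(pmulr_rge0 _ (ltr0n _ 3)) -(sum3_cycle t).
apply: sumr_ge0 => i _; apply: sumr_ge0 => j _; apply: sumr_ge0 => k _.
rewrite /t (eq_sym k i) (eq_sym k j) (eq_sym j i).
have [_|ij] := eqVneq i j; first by rewrite !andbF !mul0r !addr0.
have [_|jk] := eqVneq j k; first by rewrite !andbF !mul0r !addr0.
have [_|ik] := eqVneq i k; first by rewrite !andbF !mul0r !addr0.
rewrite !mul1r /q (hs j i k) (hs k j i) (hs i k j).
have le9 : (1 + lam i ^+ 2) * (1 + lam j ^+ 2) * (1 + lam k ^+ 2) <= 9.
  move: prod_le9; rewrite (bigD1 i)//= (bigD1 j) ?(eq_sym j)//= (bigD1 k)/=; last first.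
    by rewrite !(eq_sym k) ik jk.
  rewrite !mulrA; apply: le_trans; rewrite ler_peMr//.
    by do !(apply: mulr_ge0 => //); rewrite addr_ge0.
  by apply: le_trans (prod_1D_ge _ sq_ge0); rewrite lerDl; exact: sumr_ge0.
have := ternary_form_ge0 (h i j k) (h j k i) (h k i j)
  (lam_ge0 i) (lam_ge0 j) (lam_ge0 k) le9.
by congr (0 <= _); ring.
Qed.

End SmallProduct.

(** * Directional derivatives and C^k functions *)

Section DirectionalDerivatives.
Context {R : realType} {V : normedModType R}.
Implicit Types (f : V -> R) (x v : V).

Lemma is_derive_line f x v (t : R) : derivable f (x + t *: v) v ->
  is_derive t 1 (fun s : R => f (x + s *: v)) ('D_v f (x + t *: v)).
Proof.
move=> df.
have E : (fun h : R => h^-1 *: (((fun s : R => f (x + s *: v)) \o shift t) (h *: 1)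
    - f (x + t *: v))) =
  (fun h => h^-1 *: ((f \o shift (x + t *: v)) (h *: v) - f (x + t *: v))).
  apply/funext => h /=; congr (_ *: (f _ - _)).
  by rewrite [_%:A]mulr1 scalerDl addrCA.
by apply: DeriveDef; rewrite /derivable /derive E.
Qed.

(** Writing the intermediate parameter as [c * s] with c in (0, 1) covers both signs of s and s = 0
    at once. *)
Lemma mvt_line f x v (s : R) : (forall y, derivable f y v) ->
  exists2 c : R, 0 < c < 1 &
    f (x + s *: v) - f x = s * 'D_v f (x + (c * s) *: v).
Proof.
move=> df; pose g (t : R) := f (x + t *: v).
have dg t : is_derive t (1 : R) g ('D_v f (x + t *: v)) by exact: is_derive_line.
have cg (A : set R) : {within A, continuous g}.
  apply: continuous_subspaceT => t; apply: differentiable_continuous.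
  exact/derivable1_diffP/ex_derive.
have g0 : g 0 = f x by rewrite /g scale0r addr0.
rewrite -g0 -/(g s); have [s0|s0|<-] := ltgtP 0 s; last first.
- by exists (1 / 2); [lra|rewrite mul0r subrr].
- have [c + E] := MVT s0 (fun t _ => dg t) (cg _).
  rewrite in_itv /= => /andP[sc c0]; exists (c / s).
    by rewrite ltr_ndivlMr// mul0r c0 ltr_ndivrMr// mul1r.
  by rewrite divfK ?lt_eqF// -opprB E sub0r; ring.
- have [c + ->] := MVT s0 (fun t _ => dg t) (cg _).
  rewrite in_itv /= subr0 => /andP[c0 cs]; exists (c / s).
    by rewrite divr_gt0//= ltr_pdivrMr// mul1r.
  by rewrite divfK ?gt_eqF// mulrC.
Qed.

Lemma derive_comp (phi : R -> R) f x v :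
  derivable f x v -> derivable phi (f x) 1 ->
  derivable (fun y => phi (f y)) x v /\
  'D_v (fun y => phi (f y)) x = 'D_1 phi (f x) * 'D_v f x.
Proof.
move=> df dphi; have df' : derivable f (x + 0 *: v) v by rewrite scale0r addr0.
have dl := is_derive_line df'.
have E : f x = f (x + 0 *: v) by rewrite scale0r addr0.
pose g (s : R) := f (x + s *: v).
have dg : derivable g 0 1 by exact: ex_derive.
have dphi' : derivable phi (g 0) 1 by rewrite /g -E.
have dc : derivable (phi \o g) 0 1.
  exact: ((derivable1_diffP (phi \o g) 0).2 (differentiable_comp
    ((derivable1_diffP g 0).1 dg) ((derivable1_diffP phi (g 0)).1 dphi'))).
have Q : (fun h : R => h^-1 *: (((phi \o g) \o shift 0) (h *: 1) - (phi \o g) 0)) =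
   (fun h => h^-1 *: (((fun y => phi (f y)) \o shift x) (h *: v) - phi (f x))).
  apply/funext => h /=; rewrite /g scale0r !addr0 [_%:A]mulr1.
  by rewrite [x + _]addrC.
have dcf : derivable (fun y => phi (f y)) x v by rewrite /derivable -Q.
split=> //.
have -> : 'D_v (fun y => phi (f y)) x = derive1 (phi \o g) 0.
  by rewrite derive1E /derive Q.
rewrite (derive1_comp dg dphi') !derive1E /g -E; congr (_ * _).
by rewrite (@derive_val _ _ _ _ _ _ _ dl) scale0r addr0.
Qed.

End DirectionalDerivatives.

Section LinearityInDirection.
Context {R : realType} {V : normedModType R}.
Implicit Types (f : V -> R) (x v : V).

Lemma derive_scale f x v (s : R) : derivable f x v ->
  derivable f x (s *: v) /\ 'D_(s *: v) f x = s * 'D_v f x.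
Proof.
move=> df; pose g (t : R) := f (t *: v + x).
have dg : derivable g (s *: (0 : R)) 1 by rewrite scaler0; move/derivable1P: df.
have ds : is_derive (0 : R) (1 : R) (s \*: @idfun R) (s *: (1 : R)).
  exact: is_deriveZ.
have [dgs Dgs] := derive_comp (@ex_derive _ _ _ _ _ _ _ ds) dg.
have Dv : 'D_v f x = 'D_1 g (s *: (0 : R)).
  have E : (fun h : R => h^-1 *: ((g \o shift 0) (h *: 1) - g 0)) =
      (fun h => h^-1 *: ((f \o shift x) (h *: v) - f x)).
    by apply/funext => h /=; rewrite /g addr0 [h%:A]mulr1 scale0r add0r.
  by rewrite scaler0 /derive E.
have E : (fun h : R => h^-1 *: (((fun h : R => g (s *: h)) \o shift 0) (h *: 1)
    - g (s *: (0 : R)))) =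
  (fun h => h^-1 *: ((f \o shift x) (h *: (s *: v)) - f x)).
  apply/funext => h /=.
  by rewrite addr0 [h%:A]mulr1 /g scaler0 scale0r add0r scalerA [s *: h]mulrC.
split; first by move: dgs; rewrite /derivable E.
have -> : 'D_(s *: v) f x = 'D_1 (fun h : R => g (s *: h)) 0.
  by rewrite /derive E.
by rewrite Dgs -Dv (@derive_val _ _ _ _ _ _ _ ds) [_%:A]mulr1 mulrC.
Qed.

(** Full differentiability is not assumed. The increment is split into a leg along a and a leg along
    b; the mean value theorem on the second leg and continuity of the b-derivative at x give the
    limit. *)
Lemma derive_addv f x a b :
  (forall y, derivable f y a) -> (forall y, derivable f y b) ->
  {for x, continuous ('D_b f)} ->
  derivable f x (a + b) /\ 'D_(a + b) f x = 'D_a f x + 'D_b f x.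
Proof.
move=> da db cb.
suff H : (fun h : R => h^-1 *: ((f \o shift x) (h *: (a + b)) - f x)) @ 0^'
    --> 'D_a f x + 'D_b f x.
  by split; [apply/cvg_ex; exists ('D_a f x + 'D_b f x)|exact: cvg_lim].
have E : (fun h : R => h^-1 *: ((f \o shift x) (h *: (a + b)) - f x)) =
  (fun h => h^-1 *: ((f \o shift x) (h *: a) - f x)
     + h^-1 * (f (x + h *: a + h *: b) - f (x + h *: a))).
  apply/funext => h /=; rewrite -scalerDr; congr (_ *: _).
  rewrite scalerDr (addrC (h *: a + _)) addrA (addrC (h *: a) x); ring.
rewrite E; apply: cvgD; first exact: da.
apply/cvgrPdist_lt => e e0.
have /cvgrPdist_lt/(_ _ e0)/nbhs_ballP[d /= d0 Hd] := cb.
near=> h.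
have h0 : h != 0 by near: h; exact: nbhs_dnbhs_neq.
have [c /andP[/ltW c0 /ltW c1] ->] := mvt_line (x + h *: a) h db.
have ch : `|c * h| <= `|h| by rewrite normrM ger0_norm// ler_piMl.
rewrite mulrA mulVf// mul1r; apply: Hd.
rewrite -ball_normE /= -addrA opprD addrA subrr add0r normrN.
apply: le_lt_trans (ler_normD _ _) _; rewrite !normrZ.
apply: (@le_lt_trans _ _ (`|h| * (`|a| + `|b|))).
  by rewrite mulrDr lerD2l -normrM ler_wpM2r.
have S0 : 0 < `|a| + `|b| + 1 by rewrite ltr_wpDl ?addr_ge0.
apply: (@le_lt_trans _ _ (`|h| * (`|a| + `|b| + 1))).
  by rewrite ler_wpM2l// lerDl.
rewrite -ltr_pdivlMr//; near: h.
apply: dnbhs0_lt; exact: divr_gt0.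
Unshelve. all: by end_near. Qed.

End LinearityInDirection.

Section ContinuousReal.
Context {R : realType} {T : topologicalType}.
Implicit Types f g : T -> R.

Lemma continuous_addr f g :
  continuous f -> continuous g -> continuous (fun x => f x + g x).
Proof. by move=> cf cg x; apply: cvgD; [exact: cf|exact: cg]. Qed.

Lemma continuous_mulr f g :
  continuous f -> continuous g -> continuous (fun x => f x * g x).
Proof. by move=> cf cg x; apply: cvgM; [exact: cf|exact: cg]. Qed.

Lemma continuous_invr f :
  (forall x, f x != 0) -> continuous f -> continuous (fun x => (f x)^-1).
Proof. by move=> f0 cf x; apply: cvgV; [exact: f0|exact: cf]. Qed.

End ContinuousReal.

Section CkFunctions.
Context {R : realType} {n : nat}.
Implicit Types (f g : 'rV[R]_n -> R) (x v : 'rV[R]_n) (i j : 'I_n).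

Lemma Ck_continuous k f : Ck k f -> continuous f.
Proof. by case: k => [|k] []. Qed.

Lemma Ck_derivable k f : Ck k.+1 f ->
  forall i x, derivable f x (basis_vec i).
Proof. by case=> _ H i; have [] := H i. Qed.

Lemma Ck_partial k f : Ck k.+1 f -> forall i, Ck k (partial i f).
Proof. by case=> _ H i; have [] := H i. Qed.

Arguments Ck_derivable {k f} _ _ _.
Arguments Ck_partial {k f} _ _.

Lemma CkW k f : Ck k.+1 f -> Ck k f.
Proof.
elim: k f => [|k IH] f [cf df]; first by split.
by split=> // i; have [dfi cfi] := df i; split=> //; exact: IH.
Qed.

Lemma CkS k f : continuous f -> (forall i x, derivable f x (basis_vec i)) ->
  (forall i, Ck k (partial i f)) -> Ck k.+1 f.
Proof. by split=> // i; split. Qed.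

Lemma Ck_cst k (c : R) : Ck k (fun _ : 'rV[R]_n => c).
Proof.
elim: k c => [|k IH] c; first by split=> //; exact: cst_continuous.
apply: CkS => [|i x|i]; [exact: cst_continuous|exact: derivable_cst|].
rewrite (_ : partial i _ = fun=> 0)//.
by apply/funext => x; exact: derive_cst.
Qed.

Lemma partial_cst i (c : R) x : partial i (fun=> c) x = 0.
Proof. exact: derive_cst. Qed.

Lemma partialD i f g x : derivable f x (basis_vec i) ->
  derivable g x (basis_vec i) ->
  partial i (fun y => f y + g y) x = partial i f x + partial i g x.
Proof. by move=> df dg; exact: (deriveD df dg). Qed.

Lemma partialM i f g x : derivable f x (basis_vec i) ->
  derivable g x (basis_vec i) ->
  partial i (fun y => f y * g y) x = partial i f x * g x + f x * partial i g x.
Proof.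
move=> df dg; rewrite /partial addrC [_ * g x]mulrC; exact: (deriveM df dg).
Qed.

Lemma CkD k f g : Ck k f -> Ck k g -> Ck k (fun x => f x + g x).
Proof.
elim: k f g => [|k IH] f g Cf Cg.
  by split=> //; exact: continuous_addr (Ck_continuous Cf) (Ck_continuous Cg).
apply: CkS => [|i x|i].
    exact: continuous_addr (Ck_continuous Cf) (Ck_continuous Cg).
  by have := derivableD (Ck_derivable Cf i x) (Ck_derivable Cg i x); apply.
rewrite (_ : partial i _ = fun x => partial i f x + partial i g x).
  exact: IH (Ck_partial Cf i) (Ck_partial Cg i).
by apply/funext => x; exact: (partialD (Ck_derivable Cf i x) (Ck_derivable Cg i x)).
Qed.

Lemma CkM k f g : Ck k f -> Ck k g -> Ck k (fun x => f x * g x).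
Proof.
elim: k f g => [|k IH] f g Cf Cg.
  by split=> //; exact: continuous_mulr (Ck_continuous Cf) (Ck_continuous Cg).
apply: CkS => [|i x|i].
    exact: continuous_mulr (Ck_continuous Cf) (Ck_continuous Cg).
  by have := derivableM (Ck_derivable Cf i x) (Ck_derivable Cg i x); apply.
rewrite (_ : partial i _ = fun x => partial i f x * g x + f x * partial i g x).
  have [Pf Pg] := (Ck_partial Cf i, Ck_partial Cg i).
  by apply: CkD; apply: IH => //; exact: CkW.
by apply/funext => x; exact: (partialM (Ck_derivable Cf i x) (Ck_derivable Cg i x)).
Qed.

Lemma CkZ k (c : R) f : Ck k f -> Ck k (fun x => c * f x).
Proof. by move=> Cf; apply: CkM => //; exact: Ck_cst. Qed.

Lemma partialZ i (c : R) f x : derivable f x (basis_vec i) ->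
  partial i (fun y => c * f y) x = c * partial i f x.
Proof.
move=> df; have dc : derivable (fun=> c) x (basis_vec i) by exact: derivable_cst.
by rewrite (partialM dc df) partial_cst mul0r add0r.
Qed.

Lemma CkN k f : Ck k f -> Ck k (fun x => - f x).
Proof.
by move=> /(CkZ (-1)); congr Ck; apply/funext => x; rewrite mulN1r.
Qed.

Lemma Ck_sum k (I : Type) (r : seq I) (P : pred I) (F : I -> 'rV[R]_n -> R) :
  (forall a, Ck k (F a)) -> Ck k (fun x => \sum_(a <- r | P a) F a x).
Proof.
move=> CF; elim: r => [|a r IH].
  rewrite (_ : (fun _ => _) = fun=> 0); first exact: Ck_cst.
  by apply/funext => x; rewrite big_nil.
rewrite (_ : (fun _ => _) = if P a then fun x => F a x + \sum_(b <- r | P b) F b x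
  else fun x => \sum_(b <- r | P b) F b x).
  by case: ifP => // _; exact: CkD.
by apply/funext => x; rewrite big_cons; case: ifP.
Qed.

Lemma Ck_prod k (I : Type) (r : seq I) (P : pred I) (F : I -> 'rV[R]_n -> R) :
  (forall a, Ck k (F a)) -> Ck k (fun x => \prod_(a <- r | P a) F a x).
Proof.
move=> CF; elim: r => [|a r IH].
  rewrite (_ : (fun _ => _) = fun=> 1); first exact: Ck_cst.
  by apply/funext => x; rewrite big_nil.
rewrite (_ : (fun _ => _) = if P a then fun x => F a x * \prod_(b <- r | P b) F b x
  else fun x => \prod_(b <- r | P b) F b x).
  by case: ifP => // _; exact: CkM.
by apply/funext => x; rewrite big_cons; case: ifP.
Qed.

Lemma partial_sum i (I : Type) (r : seq I) (P : pred I)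
    (F : I -> 'rV[R]_n -> R) x : (forall a, Ck 1 (F a)) ->
  partial i (fun y => \sum_(a <- r | P a) F a y) x
    = \sum_(a <- r | P a) partial i (F a) x.
Proof.
move=> CF; elim: r => [|a r IH].
  rewrite big_nil (_ : (fun _ => _) = fun=> 0) ?partial_cst//.
  by apply/funext => y; rewrite big_nil.
rewrite (_ : (fun _ => _) = if P a then fun x => F a x + \sum_(b <- r | P b) F b x
  else fun x => \sum_(b <- r | P b) F b x).
  rewrite big_cons; case: ifP => // _; rewrite partialD ?IH//.
    exact: (Ck_derivable (CF a)).
  exact: (Ck_derivable (Ck_sum _ _ CF)).
by apply/funext => y; rewrite big_cons; case: ifP.
Qed.

Lemma is_derive_coord j x v : is_derive x v (fun y : 'rV[R]_n => y 0 j) (v 0 j).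
Proof.
have E : \forall h \near (0 : R)^',
   v 0 j = h^-1 *: ((((fun y : 'rV[R]_n => y 0 j) \o shift x) (h *: v)) - x 0 j).
  near=> h; rewrite /= !mxE addrK [_ *: _]mulrA mulVf ?mul1r//.
  by near: h; exact: nbhs_dnbhs_neq.
have C : (fun h : R =>
    h^-1 *: ((((fun y : 'rV[R]_n => y 0 j) \o shift x) (h *: v)) - x 0 j))
    @ 0^' --> v 0 j.
  by apply: (cvg_trans (near_eq_cvg E)); exact: cvg_cst.
by apply: DeriveDef; [apply/cvg_ex; exists (v 0 j)|exact: cvg_lim].
Unshelve. all: by end_near. Qed.

Lemma partial_coord i j x : partial i (fun y : 'rV[R]_n => y 0 j) x = (j == i)%:R.
Proof.
by rewrite /partial (@derive_val _ _ _ _ _ _ _ (is_derive_coord j x _)) !mxE.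
Qed.

Lemma Ck_coord k j : Ck k (fun y : 'rV[R]_n => y 0 j).
Proof.
case: k => [|k]; first by split=> //; exact: coord_continuous.
apply: CkS => [|i x|i]; first exact: coord_continuous.
  exact: (@ex_derive _ _ _ _ _ _ _ (is_derive_coord j x _)).
rewrite (_ : partial i _ = fun=> (j == i)%:R); first exact: Ck_cst.
by apply/funext => x; exact: partial_coord.
Qed.

Lemma partial_comp i (phi : R -> R) f x : derivable f x (basis_vec i) ->
  derivable phi (f x) 1 ->
  partial i (fun y => phi (f y)) x = 'D_1 phi (f x) * partial i f x.
Proof. by move=> df dphi; have [] := derive_comp df dphi. Qed.

Lemma partial_expR i f x : derivable f x (basis_vec i) ->
  partial i (fun y => expR (f y)) x = expR (f x) * partial i f x.
Proof.
move=> df; rewrite (partial_comp df (@derivable_expR _ (f x))).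
by rewrite (@derive_val _ _ _ _ _ _ _ (is_derive_expR _)).
Qed.

Lemma Ck_expR k f : Ck k f -> Ck k (fun x => expR (f x)).
Proof.
have cE g : continuous g -> continuous (fun x => expR (g x)).
  by move=> cg x; apply: continuous_comp; [exact: cg|exact: continuous_expR].
elim: k f => [|k IH] f Cf; first by split=> //; apply: cE; exact: (Ck_continuous Cf).
apply: CkS => [|i x|i]; first by apply: cE; exact: (Ck_continuous Cf).
  have [//] := derive_comp (Ck_derivable Cf i x) (@derivable_expR _ (f x)).
rewrite (_ : partial i _ = fun x => expR (f x) * partial i f x).
  by apply: CkM; [apply: IH; exact: CkW|exact: (Ck_partial Cf)].
by apply/funext => x; apply: partial_expR; exact: (Ck_derivable Cf).
Qed.

Lemma partialV i f x : f x != 0 -> derivable f x (basis_vec i) ->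
  partial i (fun y => (f y)^-1) x = - ((f x)^-1 * (f x)^-1 * partial i f x).
Proof.
move=> f0 df; rewrite [LHS](deriveV f0 df) -[_ *: _]/(_ * _) mulNr expr2 invfM.
by [].
Qed.

Lemma CkV k f : (forall x, f x != 0) -> Ck k f -> Ck k (fun x => (f x)^-1).
Proof.
move=> f0; have cV : continuous f -> continuous (fun x => (f x)^-1).
  exact: continuous_invr.
elim: k => [|k IH] Cf; first by split=> //; apply: cV; exact: (Ck_continuous Cf).
apply: CkS => [|i x|i]; first by apply: cV; exact: (Ck_continuous Cf).
  by apply: derivableV => //; exact: (Ck_derivable Cf).
rewrite (_ : partial i _ = fun x => - ((f x)^-1 * (f x)^-1 * partial i f x)).
  have IHf := IH (CkW Cf).
  by apply: CkN; apply: CkM; [exact: CkM|exact: (Ck_partial Cf)].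
by apply/funext => x; apply: partialV => //; exact: (Ck_derivable Cf).
Qed.

Lemma partial_ln i f x : 0 < f x -> derivable f x (basis_vec i) ->
  partial i (fun y => ln (f y)) x = (f x)^-1 * partial i f x.
Proof.
move=> f0 df; have dln := is_derive1_ln f0.
rewrite (partial_comp df (@ex_derive _ _ _ _ _ _ _ dln)).
by rewrite (@derive_val _ _ _ _ _ _ _ dln).
Qed.

Lemma Ck_ln k f : (forall x, 0 < f x) -> Ck k f -> Ck k (fun x => ln (f x)).
Proof.
move=> f0; have cL : continuous f -> continuous (fun x => ln (f x)).
  by move=> cf x; apply: continuous_comp; [exact: cf|exact: continuous_ln].
case: k => [|k] Cf; first by split=> //; apply: cL; exact: (Ck_continuous Cf).
apply: CkS => [|i x|i]; first by apply: cL; exact: (Ck_continuous Cf).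
  have dln := is_derive1_ln (f0 x).
  have [//] := derive_comp (Ck_derivable Cf i x) (@ex_derive _ _ _ _ _ _ _ dln).
rewrite (_ : partial i _ = fun x => (f x)^-1 * partial i f x).
  apply: CkM; last exact: (Ck_partial Cf).
  by apply: CkV; [move=> x; rewrite gt_eqF|exact: CkW].
by apply/funext => x; apply: partial_ln => //; exact: (Ck_derivable Cf).
Qed.

End CkFunctions.

Arguments Ck_derivable {R n k f} _ _ _.
Arguments Ck_partial {R n k f} _ _.

Section SecondOrder.
Context {R : realType} {n : nat}.
Implicit Types (f : 'rV[R]_n -> R) (x v : 'rV[R]_n) (i j : 'I_n).

Lemma Ck1_derive f x v : Ck 1 f ->
  derivable f x v /\ 'D_v f x = \sum_i v 0 i * partial i f x.
Proof.
move=> Cf.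
suff H (r : seq 'I_n) y :
    derivable f y (\sum_(i <- r) v 0 i *: basis_vec i) /\
    'D_(\sum_(i <- r) v 0 i *: basis_vec i) f y
      = \sum_(i <- r) v 0 i * partial i f y.
  by have := H (index_enum _) x; rewrite -row_sum_delta.
elim: r y => [|i r IH] y.
  by rewrite !big_nil derive0; split=> //; exact: derivable0.
have dZ z := derive_scale (v 0 i) (Ck_derivable Cf i z).
rewrite !big_cons addrC.
have cZ : continuous ('D_(v 0 i *: basis_vec i) f).
  rewrite (_ : 'D_(_) f = fun z => v 0 i * partial i f z).
    apply: continuous_mulr; first exact: cst_continuous.
    exact: Ck_continuous (Ck_partial Cf i).
  by apply/funext => z; exact: (dZ z).2.
have [d ->] := derive_addv (fun z => (IH z).1) (fun z => (dZ z).1) (cZ y).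
by split=> //; rewrite (IH y).2 (dZ y).2 addrC.
Qed.

Lemma derive_translate f x v w : derivable f (x + w) v ->
  derivable (fun y => f (y + w)) x v /\
  'D_v (fun y => f (y + w)) x = 'D_v f (x + w).
Proof.
have E : (fun h : R => h^-1 *: (((fun y => f (y + w)) \o shift x) (h *: v)
    - f (x + w))) =
  (fun h => h^-1 *: ((f \o shift (x + w)) (h *: v) - f (x + w))).
  by apply/funext => h /=; rewrite addrA.
by rewrite /derivable /derive E.
Qed.

Lemma schwarz f x i j : Ck 2 f ->
  partial i (partial j f) x = partial j (partial i f) x.
Proof.
move=> Cf.
have cH a b : continuous (partial a (partial b f)).
  exact: Ck_continuous (Ck_partial (Ck_partial Cf b) a).
(* Both mixed partials are intermediate values of the same second difference. *)
have mixed (a b : 'I_n) (t : R) : exists2 c : R * R,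
    (0 < c.1 < 1) && (0 < c.2 < 1) &
    f (x + t *: basis_vec a + t *: basis_vec b) - f (x + t *: basis_vec a)
      - (f (x + t *: basis_vec b) - f x)
    = t * (t * partial b (partial a f)
        (x + (c.1 * t) *: basis_vec a + (c.2 * t) *: basis_vec b)).
  pose w := t *: basis_vec b : 'rV[R]_n.
  have dg y : derivable (fun y => f (y + w) - f y) y (basis_vec a).
    have [d1 _] := derive_translate (Ck_derivable Cf a (y + w)).
    exact: (derivableB d1 (Ck_derivable Cf a y)).
  have [c c01 E] := mvt_line x t dg.
  have [b' b01 E'] := mvt_line (x + (c * t) *: basis_vec a) t
    (fun y => Ck_derivable (Ck_partial Cf a) b y).
  exists (c, b'); rewrite /= ?c01 ?b01//.
  rewrite -[partial b _ _]/('D_(basis_vec b) (partial a f) _) -E'.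
  rewrite E; congr (_ * _).
  have [d1 D1] := derive_translate (Ck_derivable Cf a (x + (c * t) *: basis_vec a + w)).
  by rewrite (deriveB d1 (Ck_derivable Cf a _)) D1.
apply/eqP; rewrite -subr_eq0 -normr_le0 leNgt; apply/negP => e0.
set A := partial i _ x in e0; set B := partial j _ x in e0.
have e2 : 0 < `|A - B| / 2 by rewrite divr_gt0.
have near_x a b : exists2 d : R, 0 < d & forall y, `|y| < d ->
    `|partial a (partial b f) x - partial a (partial b f) (x + y)| < `|A - B| / 2.
  have /cvgrPdist_lt/(_ _ e2)/nbhs_ballP[d /= d0 Hd] := cH a b x.
  exists d => // y yx; apply: Hd.
  by rewrite -ball_normE /= opprD addrA subrr add0r normrN.
have [d1 d10 H1] := near_x i j; have [d2 d20 H2] := near_x j i.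
pose ei := basis_vec i : 'rV[R]_n; pose ej := basis_vec j : 'rV[R]_n.
have S0 : 0 < `|ei| + `|ej| + 1 by rewrite ltr_wpDl ?addr_ge0.
pose t := Num.min d1 d2 / (`|ei| + `|ej| + 1).
have t0 : 0 < t by rewrite divr_gt0// lt_min d10.
have small (c b : R) : 0 < c < 1 -> 0 < b < 1 ->
    `|(c * t) *: ei + (b * t) *: ej| < Num.min d1 d2.
  move=> /andP[c0 c1] /andP[b0 b1].
  apply: le_lt_trans (ler_normD _ _) _.
  rewrite [`|(c * t) *: ei|]normrZ [`|(b * t) *: ej|]normrZ.
  rewrite (gtr0_norm (mulr_gt0 c0 t0)) (gtr0_norm (mulr_gt0 b0 t0)).
  rewrite -[ltRHS](divfK (lt0r_neq0 S0)) -/t.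
  apply: (@le_lt_trans _ _ (t * (`|ei| + `|ej|))).
    by rewrite mulrDr; apply: lerD; apply: ler_wpM2r => //; rewrite ler_piMl ?ltW.
  by rewrite ltr_pM2l// ltrDl.
have [[a1 a2] /= /andP[a10 a20] E1] := mixed j i t.
have [[b1 b2] /= /andP[b10 b20] E2] := mixed i j t.
have := small _ _ a20 a10; have := small _ _ b10 b20; rewrite !lt_min.
move=> /andP[_ /H2 K2] /andP[/H1 K1 _].
have swap (a b c d : R) : a - b - (c - d) = a - c - (b - d) by ring.
move: E1; rewrite swap [x + _ + _]addrAC E2.
move=> /(mulfI (lt0r_neq0 t0))/(mulfI (lt0r_neq0 t0)) EE.
move: K1; rewrite [(a2 * t) *: ei + _]addrC addrA -EE => K1.
move: K2; rewrite addrA => K2.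
have tri (a b z e : R) : `|a - z| < e -> `|b - z| < e -> `|a - b| < e + e.
  move=> az bz; apply: le_lt_trans (ler_distD z _ _) _.
  by rewrite (distrC z) ltrD.
by have := tri _ _ _ _ K1 K2; rewrite -splitr ltxx.
Qed.

Lemma global_min_grad f p i : Ck 1 f -> (forall y, f p <= f y) ->
  partial i f p = 0.
Proof.
move=> Cf pmin; pose g (t : R) := f (p + t *: basis_vec i).
have dg t : is_derive t (1 : R) g ('D_(basis_vec i) f (p + t *: basis_vec i)).
  exact: is_derive_line (Ck_derivable Cf i _).
have : is_derive (0 : R) (1 : R) g 0.
  apply: (@derive1_at_min _ g (-1) 1); first lra.
  - by move=> t _; exact: (@ex_derive _ _ _ _ _ _ _ (dg t)).
  - by rewrite in_itv /=; lra.
  - by move=> t _; rewrite /g scale0r addr0.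
move/(@derive_val _ _ _ _ _ _ _).
by rewrite (@derive_val _ _ _ _ _ _ _ (dg 0)) scale0r addr0.
Qed.

(** A second derivative [s] negative at p would be negative near p. The mean value theorem, applied
    to f and then to its first derivative [q], which vanishes at p, would produce a value below the
    minimum. *)
Lemma global_min_hess f p v : Ck 2 f -> (forall y, f p <= f y) ->
  0 <= \sum_i \sum_j v 0 i * v 0 j * partial i (partial j f) p.
Proof.
move=> Cf pmin; have C1 := CkW Cf.
pose q y := \sum_j v 0 j * partial j f y.
have Cq : Ck 1 q by apply: Ck_sum => j; apply: CkZ; exact: Ck_partial Cf j.
pose s y := \sum_i v 0 i * partial i q y.
have cs : continuous s.
  apply: (@Ck_continuous _ _ 0); apply: Ck_sum => i; apply: CkZ.
  exact: Ck_partial Cq i.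
have -> : \sum_i \sum_j v 0 i * v 0 j * partial i (partial j f) p = s p.
  apply: eq_bigr => i _; rewrite /q partial_sum.
    rewrite mulr_sumr; apply: eq_bigr => j _; rewrite partialZ ?mulrA//.
    exact: Ck_derivable (Ck_partial Cf j) i p.
  by move=> j; apply: CkZ; exact: Ck_partial Cf j.
rewrite leNgt; apply/negP => s0.
have q0 : q p = 0 by rewrite /q big1// => j _; rewrite global_min_grad ?mulr0.
have [d d0 sd] : exists2 d : R, 0 < d & forall w, `|w| < d -> s (p + w) < 0.
  have ns0 : 0 < - s p by lra.
  have /cvgrPdist_lt/(_ _ ns0)/nbhs_ballP[d /= d0 Hd] := cs p.
  exists d; first exact: d0.
  move=> w wd; have : `|s p - s (p + w)| < - s p.
    by apply: Hd; rewrite -ball_normE /= opprD addrA subrr add0r normrN.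
  by move: (s _) (s _) => a b; rewrite ltr_norml => /andP[+ _]; lra.
pose t := d / (`|v| + 1).
have v1 : 0 < `|v| + 1 by rewrite ltr_wpDl.
have t0 : 0 < t by rewrite divr_gt0.
have [c /andP[c0 c1]] := mvt_line p t (fun y => (Ck1_derive y v C1).1).
have [b /andP[b0 b1]] := mvt_line p (c * t) (fun y => (Ck1_derive y v Cq).1).
rewrite (Ck1_derive _ _ C1).2 (Ck1_derive _ _ Cq).2 -/(q _) -/(s _) q0 subr0.
set w := (b * _) *: v => qy fy.
have sy : s (p + w) < 0.
  have bct := mulr_gt0 b0 (mulr_gt0 c0 t0).
  apply: sd; rewrite /w normrZ (gtr0_norm bct).
  apply: (@le_lt_trans _ _ (t * `|v|)).
    have bc1 : b * c < 1.
      by rewrite -[ltRHS]mulr1 ltr_pM// ltW.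
    by rewrite mulrA; apply: ler_wpM2r => //; rewrite ler_piMl ?ltW.
  by rewrite /t -mulrA gtr_pMr// mulrC ltr_pdivrMr// mul1r ltrDl.
have := pmin (p + t *: v); rewrite -subr_ge0 fy qy.
rewrite leNgt => /negP; apply.
by rewrite pmulr_rlt0// pmulr_rlt0// mulr_gt0.
Qed.

End SecondOrder.

(** * The maximum principle *)

Section SquaredDistance.
Context {R : realType} {n : nat}.
Implicit Types (x y : 'rV[R]_n).

(** The norm of ['rV[R]_n] is the maximum norm; the barriers need the smooth Euclidean distance,
    whose square root dominates it, so that balls remain compact. *)
Definition sqdist y x : R := \sum_i (x 0 i - y 0 i) ^+ 2.

Lemma Ck_coordB k y i : Ck k (fun x => x 0 i - y 0 i).
Proof. by apply: CkD; [exact: Ck_coord|exact: Ck_cst]. Qed.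

Lemma partial_coordB y i j x :
  partial i (fun x => x 0 j - y 0 j) x = (j == i)%:R.
Proof.
have dc : derivable (fun=> - y 0 j) x (basis_vec i) by exact: derivable_cst.
rewrite (partialD (Ck_derivable (Ck_coord 1 j) i x) dc).
by rewrite partial_coord partial_cst addr0.
Qed.

Lemma Ck_sqdist k y : Ck k (sqdist y).
Proof.
rewrite (_ : sqdist y = fun x => \sum_i (x 0 i - y 0 i) * (x 0 i - y 0 i)).
  by apply: Ck_sum => i; apply: CkM; exact: Ck_coordB.
by apply/funext => x; apply: eq_bigr => i _; rewrite expr2.
Qed.

Lemma continuous_sqdist y : continuous (sqdist y).
Proof. exact: Ck_continuous (Ck_sqdist 0 y). Qed.

Lemma partial_sqdist y i x : partial i (sqdist y) x = 2 * (x 0 i - y 0 i).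
Proof.
rewrite (_ : sqdist y = fun x => \sum_i (x 0 i - y 0 i) * (x 0 i - y 0 i)).
  rewrite partial_sum; last by move=> j; apply: CkM; exact: Ck_coordB.
  rewrite (bigD1 i)//= big1 ?addr0 => [|j ji].
    have dc := Ck_derivable (Ck_coordB 1 y i) i x.
    by rewrite (partialM dc dc) partial_coordB eqxx mul1r mulr1 mulr2n mulrDl mul1r.
  have dc := Ck_derivable (Ck_coordB 1 y j) i x.
  by rewrite (partialM dc dc) partial_coordB (negbTE ji) mul0r mulr0 addr0.
by apply/funext => z; apply: eq_bigr => j _; rewrite expr2.
Qed.

Lemma partial2_sqdist y i j x :
  partial i (partial j (sqdist y)) x = 2 * (i == j)%:R.
Proof.
rewrite (_ : partial j (sqdist y) = fun x => 2 * (x 0 j - y 0 j)).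
  rewrite (partialZ _ (Ck_derivable (Ck_coordB 1 y j) i x)).
  by rewrite partial_coordB eq_sym.
by apply/funext => z; exact: partial_sqdist.
Qed.

Lemma sqdist_ge0 y x : 0 <= sqdist y x.
Proof. by apply: sumr_ge0 => i _; exact: sqr_ge0. Qed.

Lemma sqdistxx y : sqdist y y = 0.
Proof. by apply: big1 => i _; rewrite subrr expr0n. Qed.

Lemma sqdist_eq0 y x : sqdist y x <= 0 -> x = y.
Proof.
move=> d0; apply/rowP => i; apply/eqP; rewrite -subr_eq0 -sqrf_eq0.
have : sqdist y x == 0 by rewrite eq_le d0 sqdist_ge0.
rewrite psumr_eq0; last by move=> j _; exact: sqr_ge0.
by move=> /allP/(_ i (mem_index_enum _)).
Qed.

Lemma compact_sqdist_ball (A : set 'rV[R]_n) y (r : R) :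
  closed A -> compact (A `&` [set x | sqdist y x <= r]).
Proof.
move=> cA; apply: bounded_closed_compact; last first.
  apply: closedI => //; rewrite (_ : [set x | _] = sqdist y @^-1` [set t | t <= r])//.
  by apply: closed_comp => [x _|]; [exact: continuous_sqdist|exact: closed_le].
exists (Num.sqrt r + `|y|); split; first exact: num_real.
move=> M rM x /= [_ xr]; apply: le_trans (ltW rM).
rewrite -[x](subrK y); apply: le_trans (ler_normD _ _) _; rewrite lerD2r.
rewrite [leLHS]mx_normrE bigmax_le ?sqrtr_ge0// => -[a i] _ /=.
rewrite !mxE ord1 -sqrtr_sqr ler_wsqrtr//; apply: le_trans xr.
by rewrite /sqdist (bigD1 i)//= lerDl sumr_ge0// => j _; exact: sqr_ge0.
Qed.

Lemma sqdist_ball_argmin (A : set 'rV[R]_n) (f : 'rV[R]_n -> R) y (r : R) p :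
  closed A -> continuous f -> A p -> sqdist y p <= r ->
  exists q, [/\ A q, sqdist y q <= r &
    forall x, A x -> sqdist y x <= r -> f q <= f x].
Proof.
move=> cA cf Ap pr; have cK := @compact_sqdist_ball A y r cA.
have K0 : (A `&` [set x | sqdist y x <= r]) !=set0 by exists p.
have [|q] := compact_EVT_min (f := f) K0 cK; first exact: continuous_subspaceT.
rewrite inE => -[/= Aq qr] H; exists q; split=> // x Ax xr.
by apply: H; rewrite inE.
Qed.

End SquaredDistance.

(* jet_op is kept separate from drift_op because unification on concrete partial
   derivatives unfolds limits. *)
Section JetOperator.
Context {R : realType} {n : nat} (A : 'M[R]_n) (c : 'rV[R]_n).
Implicit Types (H : 'I_n -> 'I_n -> R) (g : 'I_n -> R).

Definition jet_op H g : R :=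
  \sum_i \sum_j A i j * H i j - \sum_i c 0 i * g i.

Lemma eq_jet_op H g H' g' : (forall i j, H i j = H' i j) ->
  (forall i, g i = g' i) -> jet_op H g = jet_op H' g'.
Proof.
move=> HH gg; congr (_ - _); apply: eq_bigr => i _; last by rewrite gg.
by apply: eq_bigr => j _; rewrite HH.
Qed.

Lemma jet_opD H g H' g' : jet_op (fun i j => H i j + H' i j) (fun i => g i + g' i)
  = jet_op H g + jet_op H' g'.
Proof.
rewrite /jet_op addrACA -opprD -!big_split /=; congr (_ - _).
  apply: eq_bigr => i _; rewrite -big_split; apply: eq_bigr => j _.
  by rewrite mulrDr.
by apply: eq_bigr => i _; rewrite mulrDr.
Qed.

Lemma jet_opZ (k : R) H g :
  jet_op (fun i j => k * H i j) (fun i => k * g i) = k * jet_op H g.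
Proof.
rewrite /jet_op mulrBr !mulr_sumr; congr (_ - _).
  apply: eq_bigr => i _; rewrite mulr_sumr; apply: eq_bigr => j _.
  by rewrite mulrCA.
by apply: eq_bigr => i _; rewrite mulrCA.
Qed.

Lemma jet_op_square H g :
  jet_op (fun i j => H i j + g i * g j) g
  = jet_op H g + \sum_i \sum_j A i j * (g i * g j).
Proof.
rewrite /jet_op addrAC -big_split /=; congr (_ - _).
apply: eq_bigr => i _; rewrite -big_split /=; apply: eq_bigr => j _.
by rewrite mulrDr.
Qed.

Lemma jet_op_gram (W : 'M[R]_n) H : A = W^T *m W ->
  jet_op H (fun=> 0)
  = \sum_r \sum_i \sum_j (row r W) 0 i * (row r W) 0 j * H i j.
Proof.
move=> AW; rewrite /jet_op [X in _ - X]big1 ?subr0 => [|i _]; last by rewrite mulr0.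
rewrite [RHS]exchange_big; apply: eq_bigr => i _; rewrite [RHS]exchange_big.
apply: eq_bigr => j _; rewrite AW mxE mulr_suml; apply: eq_bigr => r _.
by rewrite !mxE.
Qed.

End JetOperator.

Section DriftOperator.
Context {R : realType} {n : nat} (a : 'rV[R]_n -> 'M[R]_n).
Implicit Types (f g : 'rV[R]_n -> R) (x y p : 'rV[R]_n).

Definition drift_op f x : R :=
  jet_op (a x) x (fun i j => partial i (partial j f) x) (fun i => partial i f x).

Lemma drift_opD f g x : Ck 2 f -> Ck 2 g ->
  drift_op (fun y => f y + g y) x = drift_op f x + drift_op g x.
Proof.
move=> Cf Cg.
have P j z : partial j (fun y => f y + g y) z = partial j f z + partial j g z.
  exact: partialD (Ck_derivable Cf j z) (Ck_derivable Cg j z).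
have P2 i j : partial i (partial j (fun y => f y + g y)) x =
    partial i (partial j f) x + partial i (partial j g) x.
  rewrite (_ : partial j _ = fun z => partial j f z + partial j g z); last exact/funext.
  exact: partialD (Ck_derivable (Ck_partial Cf j) i x)
    (Ck_derivable (Ck_partial Cg j) i x).
by rewrite -jet_opD; apply: eq_jet_op.
Qed.

Lemma drift_opZ (c : R) f x : Ck 2 f ->
  drift_op (fun y => c * f y) x = c * drift_op f x.
Proof.
move=> Cf.
have P j z : partial j (fun y => c * f y) z = c * partial j f z.
  exact: partialZ (Ck_derivable Cf j z).
have P2 i j : partial i (partial j (fun y => c * f y)) x =
    c * partial i (partial j f) x.
  rewrite (_ : partial j _ = fun z => c * partial j f z); last exact/funext.
  exact: partialZ (Ck_derivable (Ck_partial Cf j) i x).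
by rewrite -jet_opZ; apply: eq_jet_op.
Qed.

Lemma drift_op_cst f (c : R) x : (forall y, f y = c) -> drift_op f x = 0.
Proof.
move=> fc; have -> : f = fun=> c by exact/funext.
rewrite /drift_op (@eq_jet_op _ _ _ _ _ _ (fun _ _ => 0) (fun=> 0)).
- rewrite /jet_op !big1 ?subr0// => i _; rewrite ?mulr0//.
  by rewrite big1// => j _; rewrite mulr0.
- move=> i j; rewrite (_ : partial j _ = fun=> 0) ?partial_cst//.
  by apply/funext => z; rewrite partial_cst.
- by move=> i; rewrite partial_cst.
Qed.

Lemma drift_op_expR f x : Ck 2 f ->
  drift_op (fun y => expR (f y)) x = expR (f x) *
    (drift_op f x + \sum_i \sum_j a x i j * (partial i f x * partial j f x)).
Proof.
move=> Cf.
have P j z : partial j (fun y => expR (f y)) z = expR (f z) * partial j f z.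
  exact: partial_expR (Ck_derivable Cf j z).
have P2 i j : partial i (partial j (fun y => expR (f y))) x =
   expR (f x) * (partial i (partial j f) x + partial i f x * partial j f x).
  rewrite (_ : partial j _ = fun z => expR (f z) * partial j f z); last exact/funext.
  rewrite (partialM (Ck_derivable (Ck_expR Cf) i x)
    (Ck_derivable (Ck_partial Cf j) i x)) P.
  by move: (partial i f x) (partial j f x) (partial i _ x) => b c d; ring.
rewrite -(jet_op_square (a x) x (fun i j => partial i (partial j f) x)
  (fun i => partial i f x)) -jet_opZ.
exact: eq_jet_op.
Qed.

Lemma drift_op_sqdist y x : drift_op (sqdist y) x
  = 2 * (\sum_i a x i i - \sum_i x 0 i * (x 0 i - y 0 i)).
Proof.
rewrite /drift_op (@eq_jet_op _ _ _ _ _ _ (fun i j => 2 * (i == j)%:R)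
  (fun i => 2 * (x 0 i - y 0 i))); first last.
- by move=> i; exact: partial_sqdist.
- by move=> i j; exact: partial2_sqdist.
rewrite jet_opZ /jet_op; congr (_ * (_ - _)); apply: eq_bigr => i _.
rewrite (bigD1 i)//= big1 ?addr0 => [|j ji]; first by rewrite eqxx mulr1.
by rewrite eq_sym (negbTE ji) !mulr0.
Qed.

(** Positive definiteness as a factorisation: contracting [a x] with a Hessian becomes a sum of
    second derivatives along the rows of W. *)
Definition positive_coefficients := forall x,
  exists2 W : 'M[R]_n, W \in unitmx & a x = W^T *m W.

Lemma drift_op_global_min f p : positive_coefficients ->
  Ck 2 f -> (forall y, f p <= f y) -> 0 <= drift_op f p.
Proof.
move=> apos Cf pmin; have [W _ aW] := apos p.
rewrite /drift_op (@eq_jet_op _ _ _ _ _ _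
  (fun i j => partial i (partial j f) p) (fun=> 0)) //.
  rewrite (jet_op_gram _ _ aW).
  by apply: sumr_ge0 => r _; exact: (global_min_hess (row r W) Cf pmin).
by move=> i; exact: (global_min_grad i (CkW Cf) pmin).
Qed.

Lemma positive_coefficients_form x y : positive_coefficients -> x != y ->
  0 < \sum_i \sum_j a x i j * ((x 0 i - y 0 i) * (x 0 j - y 0 j)).
Proof.
move=> apos xy; have [W Wu aW] := apos x.
have E : \sum_i \sum_j a x i j * ((x 0 i - y 0 i) * (x 0 j - y 0 j)) =
    \sum_r (\sum_i W r i * (x 0 i - y 0 i)) ^+ 2.
  under [RHS]eq_bigr do rewrite expr2 mulr_suml.
  rewrite [RHS]exchange_big; apply: eq_bigr => i _.
  under [RHS]eq_bigr do rewrite mulr_sumr.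
  rewrite [RHS]exchange_big; apply: eq_bigr => j _.
  rewrite aW mxE mulr_suml; apply: eq_bigr => r _; rewrite mxE; ring.
rewrite E lt_neqAle sumr_ge0 ?andbT; last by move=> r _; exact: sqr_ge0.
rewrite eq_sym psumr_eq0; last by move=> r _; exact: sqr_ge0.
apply: contra xy => /allP H.
have Wz : W *m (x - y)^T = 0.
  apply/colP => r; rewrite !mxE; have := H r (mem_index_enum _).
  rewrite /= sqrf_eq0 => /eqP; apply: etrans.
  by apply: eq_bigr => i _; rewrite !mxE.
have : (x - y)^T = 0 by rewrite -[LHS](mulKmx Wu) Wz mulmx0.
by move/(congr1 trmx); rewrite trmxK trmx0 => /eqP; rewrite subr_eq0.
Qed.

End DriftOperator.

Section MaximumPrinciple.
Context {R : realType} {n : nat} {a : 'rV[R]_n -> 'M[R]_n}.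
Hypothesis apos : positive_coefficients a.
Hypothesis adiag : forall x i, a x i i <= 1.
Hypothesis acont : forall i j, continuous (fun x => a x i j).
Variables (w : 'rV[R]_n -> R) (C : R).
Hypothesis wC2 : Ck 2 w.
Hypothesis w_ge : forall x, C <= w x.
Hypothesis w_super : forall x, drift_op a w x <= 0.

Let wcont : continuous w. Proof. exact: Ck_continuous wC2. Qed.

(* The drift makes |x|^2 a barrier at infinity: L|x|^2 <= 2n - 2|x|^2. *)
Let barrier x : drift_op a (sqdist 0) x <= 2 * (n%:R - sqdist 0 x).
Proof.
rewrite drift_op_sqdist ler_pM2l// lerD//.
  rewrite -[n in n%:R]card_ord -sum1_card natr_sum.
  by apply: ler_sum => i _; exact: adiag.
rewrite lerN2 le_eqVlt; apply/orP; left; apply/eqP; apply: eq_bigr => i _.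
by rewrite mxE subr0 expr2.
Qed.

(** A minimum exists because e |x|^2 outweighs the lower bound C far out. There L of the sum is
    nonnegative while L w <= 0, so L|x|^2 >= 0 and the barrier puts the minimum into |q|^2 <= n, a
    ball independent of e. *)
Let perturbed_min (e : R) : 0 < e -> exists2 q, sqdist 0 q <= n%:R &
  forall x, w q + e * sqdist 0 q <= w x + e * sqdist 0 x.
Proof.
move=> e0; pose f x := w x + e * sqdist 0 x.
have Cd : Ck 2 (fun x : 'rV[R]_n => e * sqdist 0 x).
  exact: (CkZ e (Ck_sqdist 2 0)).
have Cf : Ck 2 f by exact: CkD.
have r0 : sqdist (0 : 'rV[R]_n) 0 <= (w 0 - C) / e.
  by rewrite sqdistxx divr_ge0 ?subr_ge0 // ltW.
have [q [_ qr qmin]] := sqdist_ball_argmin closedT (Ck_continuous Cf) I r0.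
have gmin x : f q <= f x.
  have [xr|xr] := leP (sqdist 0 x) ((w 0 - C) / e); first exact: qmin.
  have := qmin 0 I r0; move/le_trans; apply.
  rewrite /f sqdistxx mulr0 addr0; move: xr; rewrite ltr_pdivrMr//.
  by have := w_ge x; move: (w x) (w 0) (sqdist 0 x) => b c d; lra.
exists q => //.
have := drift_op_global_min apos Cf gmin.
rewrite (drift_opD _ _ wC2 Cd) (drift_opZ _ _ _ (Ck_sqdist 2 0)) => L0.
have := w_super q; have := barrier q; move: L0.
move: (drift_op a w q) (drift_op a (sqdist 0) q) (sqdist 0 q) => b c d L0 cd b0.
have : 0 <= e * c by lra.
by rewrite pmulr_rge0//; lra.
Qed.

Lemma superharmonic_attains_min : exists p, forall x, w p <= w x.
Proof.
have n0 : sqdist (0 : 'rV[R]_n) 0 <= n%:R by rewrite sqdistxx.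
have [p [_ pn pmin]] := sqdist_ball_argmin closedT wcont I n0.
exists p => x; rewrite leNgt; apply/negP => xp.
pose d := sqdist 0 x; have d0 : 0 <= d := sqdist_ge0 0 x.
(* With this e, the perturbed minimum q would satisfy w q <= w x + e d = w p - e, against the
   minimality of p on the ball that contains q. *)
pose e := (w p - w x) / (d + 1).
have d1 : 0 < d + 1 by rewrite ltr_wpDl.
have e0 : 0 < e by rewrite divr_gt0// subr_gt0.
have [q qn qmin] := perturbed_min e0.
have := qmin x; have := pmin q I qn; rewrite -/d.
have eq0 : 0 <= e * sqdist 0 q by rewrite mulr_ge0 ?sqdist_ge0// ltW.
have ed : e * (d + 1) = w p - w x by rewrite divfK ?gt_eqF.
move: eq0 ed e0; move: (e * _) (w p) (w x) (w q) => b c f g.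
by rewrite mulrDr mulr1; lra.
Qed.

Let exterior_ball p y : (forall x, w p <= w x) -> w p < w y ->
  exists z, [/\ w z = w p, 0 < sqdist y z &
    forall x, sqdist y x < sqdist y z -> w p < w x].
Proof.
move=> pmin py; pose K := [set x | w x <= w p].
have cK : closed K.
  rewrite (_ : K = w @^-1` [set t | t <= w p])//.
  by apply: closed_comp => [x _|]; [exact: wcont|exact: closed_le].
have Kp : K p by rewrite /K /=.
have [z [zK zr zmin]] :=
  sqdist_ball_argmin cK (@continuous_sqdist _ _ y) Kp (lexx (sqdist y p)).
exists z; split.
- by apply/eqP; rewrite eq_le pmin andbT; exact: zK.
- rewrite ltNge; apply/negP => /sqdist_eq0 zy.
  by move: zK; rewrite /K /= zy leNgt py.
- move=> x xz; rewrite ltNge; apply/negP => xp.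
  have := zmin x xp (le_trans (ltW xz) zr).
  by rewrite leNgt xz.
Qed.

Let annulus_max y (r s : R) (f : 'rV[R]_n -> R) p : continuous f ->
  s <= sqdist y p <= r -> exists2 q, s <= sqdist y q <= r &
    forall x, s <= sqdist y x <= r -> f x <= f q.
Proof.
move=> cf /andP[ps pr].
have cA : closed [set x | s <= sqdist y x].
  rewrite (_ : [set x | _] = sqdist y @^-1` [set t | s <= t])//.
  by apply: closed_comp => [x _|]; [exact: continuous_sqdist|exact: closed_ge].
have cnf : continuous (fun x => - 1 * f x).
  by apply: continuous_mulr => //; exact: cst_continuous.
have [q [/= qs qr qmin]] := sqdist_ball_argmin cA cnf ps pr.
exists q => [|x /andP[xs xr]]; first by rewrite qs.
by have := qmin x xs xr; rewrite !mulN1r lerN2.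
Qed.

(* On an annulus around y, exp(-k |x-y|^2) is a strict subsolution for large k. *)
Let hopf_barrier y (r s : R) : 0 < s -> exists k : R, 0 < k /\
  forall x, s <= sqdist y x <= r ->
    0 < drift_op a (fun x => expR (- k * sqdist y x)) x.
Proof.
move=> s0.
pose b x := \sum_i \sum_j a x i j * ((x 0 i - y 0 i) * (x 0 j - y 0 j)).
pose l x := 2 * (\sum_i a x i i - \sum_i x 0 i * (x 0 i - y 0 i)).
have cB i : continuous (fun x : 'rV[R]_n => x 0 i - y 0 i).
  exact: Ck_continuous (Ck_coordB 0 y i).
have csum (I : finType) (F : I -> 'rV[R]_n -> R) : (forall i, continuous (F i)) ->
    continuous (fun x => \sum_i F i x).
  move=> cF; apply: (@Ck_continuous _ _ 0); apply: Ck_sum => i.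
  by split; first exact: cF.
have cb : continuous b.
  apply: (csum _ _) => i; apply: (csum _ _) => j.
  apply: continuous_mulr; first exact: acont.
  by apply: continuous_mulr; exact: cB.
have cl : continuous l.
  apply: continuous_mulr; first exact: cst_continuous.
  apply: continuous_addr; first by apply: (csum _ _) => i; exact: acont.
  rewrite (_ : (fun x => - _) = fun x : 'rV[R]_n => -1 * \sum_i x 0 i * (x 0 i - y 0 i)).
    apply: continuous_mulr; first exact: cst_continuous.
    apply: (csum _ _) => i; apply: continuous_mulr => //; exact: coord_continuous.
  by apply/funext => x; rewrite mulN1r.
have Lk k x : drift_op a (fun x => expR (- k * sqdist y x)) x
    = expR (- k * sqdist y x) * (- k * l x + 4 * k ^+ 2 * b x).
  have Cq := Ck_sqdist 2 y.
  rewrite (drift_op_expR _ _ (CkZ (- k) Cq)) (drift_opZ _ _ _ Cq) drift_op_sqdist.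
  rewrite -/(l x); congr (_ * (_ + _)).
  have P i : partial i (fun x => - k * sqdist y x) x = - k * (2 * (x 0 i - y 0 i)).
    by rewrite (partialZ _ (Ck_derivable Cq i x)) partial_sqdist.
  rewrite /b mulr_sumr; apply: eq_bigr => i _; rewrite mulr_sumr.
  apply: eq_bigr => j _; rewrite !P.
  by move: (a x i j) (x 0 i - y 0 i) (x 0 j - y 0 j) => c d e; ring.
have [[p ps]|none] := pselect (exists p, s <= sqdist y p <= r); last first.
  by exists 1; split=> // x xs; case: none; exists x.
have [q qs qmin] : exists2 q, s <= sqdist y q <= r &
    forall x, s <= sqdist y x <= r -> b q <= b x.
  have cnb : continuous (fun x => -1 * b x).
    by apply: continuous_mulr => //; exact: cst_continuous.
  have [q qs qmax] := annulus_max cnb ps; exists q => // x xs.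
  by have := qmax x xs; rewrite !mulN1r lerN2.
have [t ts tmax] := annulus_max cl ps.
have bq : 0 < b q.
  apply: positive_coefficients_form => //; apply/eqP => qy.
  by move: qs; rewrite qy sqdistxx leNgt s0.
(* L of the exponential is a positive multiple of 4 k b - l; on the annulus b is at least b q > 0
   and l is at most l t, so this k leaves a margin of at least 1. *)
pose k := (`|l t| + 1) / (4 * b q).
have k0 : 0 < k by rewrite divr_gt0 ?mulr_gt0// ltr_wpDl.
exists k; split=> // x xs; rewrite Lk pmulr_rgt0 ?expR_gt0//.
have E : 4 * k * b q = `|l t| + 1.
  by rewrite mulrAC /k [_ / _]mulrC mulrA divff ?mul1r// gt_eqF// mulr_gt0.
have : 4 * k * b q <= 4 * k * b x by rewrite ler_pM2l ?qmin// mulr_gt0.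
have := tmax x xs; have := ler_norm (l t); rewrite E.
move: (l x) (l t) (b x) => lx lt bx h1 h2 h3.
rewrite (_ : _ + _ = k * (4 * k * bx - lx)); last by ring.
by rewrite mulr_gt0//; lra.
Qed.

(* If w y > min w and z is the point of the minimum set closest to y, then adding
   e (exp(-k r) - exp(-k |x - y|^2)), r = |z - y|^2, to w for small e gives a
   function with a global minimum in the annulus where L of it is negative. *)
Lemma superharmonic_constant : exists p, forall x, w x = w p.
Proof.
have [p pmin] := superharmonic_attains_min; exists p => y.
apply/eqP; rewrite eq_le pmin andbT leNgt; apply/negP => py.
have [z [zp z0 zball]] := exterior_ball pmin py.
set r := sqdist y z in z0 zball.
have s0 : 0 < r / 4 by rewrite divr_gt0.
have [k [k0 kpos]] := @hopf_barrier y r (r / 4) s0.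
have ys : sqdist y y <= r / 4 by rewrite sqdistxx ltW.
have [v [_ vs vmin]] := sqdist_ball_argmin closedT wcont I ys.
have vp : w p < w v by apply: zball; apply: le_lt_trans vs _; lra.
(* On the small ball w >= w v and E <= 1, so P exceeds w v - e = w p + e there. Hence the minimum of
   P, which is at most P z = w p, stays off that ball. *)
pose e := (w v - w p) / 2.
have e0 : 0 < e by rewrite divr_gt0// subr_gt0.
pose E x := expR (- k * sqdist y x).
have CE : Ck 2 E by apply: Ck_expR; exact: (CkZ (- k) (Ck_sqdist 2 y)).
have CE' : Ck 2 (fun x => - e * E x) by exact: (CkZ (- e) CE).
have CE'' : Ck 2 (fun x => - e * E x + e * expR (- k * r)).
  exact: (CkD CE' (Ck_cst 2 (e * expR (- k * r)))).
pose P x := w x + (- e * E x + e * expR (- k * r)).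
have CP : Ck 2 P by exact: (CkD wC2 CE'').
have zr : sqdist y z <= r by [].
have [q [_ qr qmin]] := sqdist_ball_argmin closedT (Ck_continuous CP) I zr.
have Pz : P z = w p by rewrite /P /E -/r zp mulNr addNr addr0.
have qp : P q <= w p by rewrite -Pz; exact: qmin.
have Ele x : sqdist y x <= r -> expR (- k * r) <= E x.
  by move=> xr; rewrite ler_expR !mulNr lerN2 ler_pM2l.
have Egt x : r < sqdist y x -> E x < expR (- k * r).
  by move=> xr; rewrite ltr_expR !mulNr ltrN2 ltr_pM2l.
have gmin x : P q <= P x.
  have [xr|xr] := leP (sqdist y x) r; first exact: qmin.
  apply: le_trans qp _; have : 0 <= e * (expR (- k * r) - E x).
    by apply: mulr_ge0; [exact: ltW|rewrite subr_ge0 ltW ?Egt].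
  have := pmin x; rewrite /P mulrBr (mulNr e).
  by move: (w x) (w p) (e * E x) (e * expR (- k * r)) => *; lra.
have qs : r / 4 <= sqdist y q <= r.
  rewrite qr andbT leNgt; apply/negP => qs.
  have := vmin q I (ltW qs); have : e * (1 - E q) >= 0.
    apply: mulr_ge0; first exact: ltW.
    rewrite subr_ge0 /E -[leRHS]expR0 ler_expR mulNr oppr_le0.
    by apply: mulr_ge0; [exact: ltW|exact: sqdist_ge0].
  have : 0 < e * expR (- k * r) by rewrite mulr_gt0 ?expR_gt0.
  have ee : e = (w v - w p) / 2 by [].
  move: qp ee; rewrite /P (mulNr e) mulrBr mulr1.
  by move: (e * E q) (e * expR (- k * r)) (w q) (w v) (w p) => *; lra.
have := drift_op_global_min apos CP gmin.
rewrite (drift_opD _ _ wC2 CE'') (drift_opD _ _ CE' (Ck_cst 2 _)).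
rewrite (drift_op_cst a q (fun=> erefl)) addr0 (drift_opZ _ _ _ CE).
have := w_super q; have : 0 < e * drift_op a E q by rewrite mulr_gt0// kpos.
rewrite (mulNr e).
by move: (drift_op a w q) (e * drift_op a E q) => b c; lra.
Qed.

End MaximumPrinciple.

(** * Singular frames *)

Section SpectralTheorem.
Context {R : realType}.

Lemma mul_trmx_ge0 n (v : 'rV[R]_n) : 0 <= (v *m v^T) 0 0.
Proof. by rewrite mxE sumr_ge0// => i _; rewrite mxE -expr2 sqr_ge0. Qed.

Lemma mul_trmx_eq0 n (v : 'rV[R]_n) : (v *m v^T) 0 0 <= 0 -> v = 0.
Proof.
move=> v0; apply: sqdist_eq0; apply: le_trans v0.
rewrite mxE le_eqVlt; apply/orP; left; apply/eqP; apply: eq_bigr => i _.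
by rewrite !mxE subr0 expr2.
Qed.

(* A minimiser of the Rayleigh quotient is an eigenvector. *)
Lemma symmetric_eigenvector n (A : 'M[R]_n.+1) : A^T = A ->
  exists v : 'rV[R]_n.+1, exists mu : R, v *m v^T = 1%:M /\ v *m A = mu *: v.
Proof.
move=> As; pose q (x : 'rV[R]_n.+1) := (x *m A *m x^T) 0 0.
have qE x : q x = \sum_j \sum_i x 0 i * A i j * x 0 j.
  rewrite /q mxE; apply: eq_bigr => j _; rewrite !mxE mulr_suml.
  by apply: eq_bigr => i _.
have cq : continuous q.
  rewrite (_ : q = fun x => \sum_j \sum_i x 0 i * A i j * x 0 j); last exact/funext.
  apply: (@Ck_continuous _ _ 0); apply: Ck_sum => j; apply: Ck_sum => i.
  by apply: CkM; [apply: CkM; [exact: Ck_coord|exact: Ck_cst]|exact: Ck_coord].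
have sqE (x : 'rV[R]_n.+1) : (x *m x^T) 0 0 = sqdist 0 x.
  by rewrite mxE; apply: eq_bigr => i _; rewrite !mxE subr0 expr2.
(* Intersected with the closed unit ball this set is the unit sphere. *)
have cA : closed [set x : 'rV[R]_n.+1 | 1 <= sqdist 0 x].
  rewrite (_ : [set x | _] = sqdist (0 : 'rV[R]_n.+1) @^-1` [set t | 1 <= t])//.
  by apply: closed_comp => [x _|]; [exact: continuous_sqdist|exact: closed_ge].
have e1 : sqdist 0 (delta_mx 0 0 : 'rV[R]_n.+1) = 1.
  rewrite /sqdist (bigD1 ord0)//= big1 ?addr0.
    by rewrite !mxE eqxx subr0 expr1n.
  by move=> i i0; rewrite !mxE (negbTE i0) subr0 expr0n.
have Ae : [set x : 'rV[R]_n.+1 | 1 <= sqdist 0 x] (delta_mx 0 0) by rewrite /= e1.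
have e1' : sqdist 0 (delta_mx 0 0 : 'rV[R]_n.+1) <= 1 by rewrite e1.
have [v [/= v1 v1' vmin]] := sqdist_ball_argmin cA cq Ae e1'.
have vv : (v *m v^T) 0 0 = 1 by rewrite sqE; apply/eqP; rewrite eq_le v1' v1.
pose mu := q v; pose M := A - mu%:M.
have Ms : M^T = M by rewrite /M linearB /= As tr_scalar_mx.
have qM (x : 'rV[R]_n.+1) : (x *m M *m x^T) 0 0 = q x - mu * (x *m x^T) 0 0.
  rewrite /M mulmxBr mulmxBl mul_mx_scalar -scalemxAl.
  by rewrite [LHS]mxE [X in _ + X]mxE [in X in - X]mxE.
have Mge (x : 'rV[R]_n.+1) : 0 <= (x *m M *m x^T) 0 0.
  rewrite qM; have [x0|] := leP ((x *m x^T) 0 0) 0.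
    by rewrite (mul_trmx_eq0 x0) /q !mul0mx mxE mulr0 subrr.
  set s := (x *m x^T) 0 0 => s0.
  pose c := (Num.sqrt s)^-1.
  have cs : c ^+ 2 * s = 1 by rewrite exprVn sqr_sqrtr ?ltW// mulVf// gt_eqF.
  have c0 : 0 < c ^+ 2 by rewrite exprn_gt0// invr_gt0 sqrtr_gt0.
  have cq2 : q (c *: x) = c ^+ 2 * q x.
    rewrite /q -scalemxAl -scalemxAl linearZ /= -scalemxAr scalerA -expr2.
    by rewrite mxE.
  have cx1 : sqdist 0 (c *: x) = 1.
    by rewrite -sqE -scalemxAl linearZ /= -scalemxAr scalerA -expr2 mxE.
  have := vmin (c *: x); rewrite cx1 cq2 -/mu => /(_ (lexx _) (lexx _)) mule.
  rewrite -(pmulr_rge0 _ c0) mulrBr mulrCA cs mulr1; lra.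
have vM : v *m A - mu *: v = v *m M by rewrite mulmxBr mul_mx_scalar.
exists v, mu; split.
  by apply/matrixP => i j; rewrite !ord1 vv mxE.
apply/eqP; rewrite -subr_eq0 vM; apply/eqP; move: M Ms qM Mge {vM} => M Ms qM Mge.
apply: mul_trmx_eq0; set y := v *m M; set s := (y *m y^T) 0 0.
have s0 : 0 <= s by exact: mul_trmx_ge0.
pose c := (y *m M *m y^T) 0 0; have c0 : 0 <= c by exact: Mge.
have line (t : R) : ((v + t *: y) *m M *m (v + t *: y)^T) 0 0 = 2 * t * s + t ^+ 2 * c.
  have vMv : (v *m M *m v^T) 0 0 = 0 by rewrite qM vv mulr1 subrr.
  have yMv : y *m M *m v^T = y *m y^T by rewrite -mulmxA -[M in M *m v^T]Ms -trmx_mul.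
  rewrite [(v + _)^T]linearD /= linearZ /= !mulmxDl !mulmxDr -/y -!scalemxAl.
  rewrite yMv -!scalemxAr.
  have addE (B B' : 'M[R]_1) : (B + B') 0 0 = B 0 0 + B' 0 0 by rewrite mxE.
  have sclE k (B : 'M[R]_1) : (k *: B) 0 0 = k * B 0 0 by rewrite mxE.
  by rewrite !addE !sclE vMv -/s -/c; ring.
have c1 : 0 < c + 1 by rewrite ltr_wpDl.
(* M is positive semidefinite and vanishes on v, so its value along the line is 2ts + t^2 c >= 0.
   This t makes it negative unless s = 0; the denominator c + 1 avoids the case c = 0. *)
have := Mge (v + (- s / (c + 1)) *: y); rewrite line.
have -> : 2 * (- s / (c + 1)) * s + (- s / (c + 1)) ^+ 2 * c =
   - (s ^+ 2 * (c + 2) / (c + 1) ^+ 2) by field; rewrite gt_eqF.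
rewrite oppr_ge0 pmulr_lle0 ?invr_gt0 ?exprn_gt0// pmulr_lle0; last lra.
by rewrite real_exprn_even_le0 ?num_real//= => /eqP->.
Qed.

Lemma unit_row_extension n (v : 'rV[R]_n.+1) : v *m v^T = 1%:M ->
  exists2 Q : 'M[R]_n.+1, Q *m Q^T = 1%:M & delta_mx 0 0 *m Q = v.
Proof.
move=> vv; pose e : 'rV[R]_n.+1 := delta_mx 0 0.
have ee : e *m e^T = 1%:M.
  apply/matrixP => i j; rewrite !ord1 !mxE (bigD1 ord0)//= big1 ?addr0.
    by rewrite !mxE eqxx mul1r.
  by move=> k k0; rewrite !mxE (negbTE k0) mul0r.
have [->|ve] := eqVneq v e; first by exists 1%:M; rewrite ?mulmx1 ?trmx1 ?mulmx1.
(* Householder reflection exchanging e and v *)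
pose w := v - e; pose s := (w *m w^T) 0 0.
have s0 : s != 0.
  apply: contra ve => /eqP s0; rewrite -subr_eq0; apply/eqP.
  by apply: mul_trmx_eq0; rewrite -/w -/s s0.
have wws : w *m w^T = s%:M by apply/matrixP => i j; rewrite !ord1 [RHS]mxE.
pose S : 'M[R]_n.+1 := w^T *m w; pose Q := 1%:M - (2 / s) *: S.
have SS : S *m S = s *: S.
  by rewrite /S mulmxA -(mulmxA w^T) wws mul_mx_scalar scalemxAl.
have Qs : Q^T = Q.
  by rewrite /Q linearB linearZ /= [1%:M^T]trmx1 /S trmx_mul trmxK.
exists Q.
  rewrite Qs /Q; move: S SS {Q Qs} => S SS.
  rewrite mulmxBl mul1mx mulmxBr mulmx1 -!scalemxAl -!scalemxAr.
  rewrite SS !scalerA (_ : 2 / s * (2 / s) * s = 2 / s + 2 / s); last by field.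
  by rewrite scalerDl opprB addrK subrK.
rewrite -/e /Q mulmxBr mulmx1 -scalemxAr /S mulmxA.
have c1 : e *m v^T = (v *m e^T)^T by rewrite trmx_mul trmxK.
have : s = 2 - 2 * (e *m v^T) 0 0.
  rewrite /s /w linearB /= mulmxBl !mulmxBr vv ee.
  have addE (B B' : 'M[R]_1) : (B + B') 0 0 = B 0 0 + B' 0 0 by rewrite mxE.
  have oppE (B : 'M[R]_1) : (- B) 0 0 = - B 0 0 by rewrite mxE.
  rewrite !(addE, oppE) c1 [(v *m e^T)^T 0 0]mxE [1%:M 0 0]mxE eqxx.
  by move: ((v *m e^T) 0 0) => k; rewrite mulr1n; ring.
set k := (e *m v^T) 0 0 => sk.
have -> : e *m w^T = (- (s / 2))%:M.
  apply/matrixP => i j; rewrite !ord1 [RHS]mxE eqxx mulr1n.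
  rewrite /w linearB /= mulmxBr ee [LHS]mxE [X in _ + X]mxE [1%:M 0 0]mxE eqxx.
  by rewrite -/k sk mulr1n; field.
rewrite mul_scalar_mx scalerA (_ : 2 / s * - (s / 2) = -1); last by field.
by rewrite scaleN1r opprK /w addrC subrK.
Qed.

Lemma symmetric_diagonalization n (A : 'M[R]_n) : A^T = A ->
  exists P : 'M[R]_n, exists d : 'rV[R]_n,
    P *m P^T = 1%:M /\ A = P^T *m diag_mx d *m P.
Proof.
elim: n A => [|n IH] A As.
  exists 1%:M, 0; split; first by rewrite mul1mx trmx1.
  by apply/matrixP => -[].
have [v [mu [vv vA]]] := symmetric_eigenvector As.
have [Q QQ eQ] := unit_row_extension vv.
have QQ' := mulmx1C QQ.
pose B0 := Q *m A *m Q^T; pose B : 'M[R]_(1 + n) := B0.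
have Bs : B^T = B by rewrite /B /B0 !trmx_mul trmxK As mulmxA.
have eB : (delta_mx 0 0 : 'rV[R]_n.+1) *m B0 = mu *: delta_mx 0 0.
  by rewrite /B0 /B0 !mulmxA eQ vA -scalemxAl -eQ -mulmxA QQ mulmx1.
have eBi (i j : 'I_(1 + n)) : i = 0%N :> nat -> B i j = mu * (j == 0%N :> nat)%:R.
  move=> i0; have -> : i = ord0 by exact: val_inj.
  have := congr1 (fun M : 'rV[R]_n.+1 => M 0 j) eB.
  by rewrite -rowE !mxE eqxx.
have ul : ulsubmx B = mu%:M.
  by apply/matrixP => i j; rewrite !ord1 [LHS]mxE [LHS]mxE eBi// !mxE eqxx mulr1.
have ur : ursubmx B = 0.
  by apply/matrixP => i j; rewrite !ord1 [LHS]mxE [LHS]mxE eBi// mxE mulr0.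
have dl : dlsubmx B = 0.
  by rewrite -[dlsubmx B]trmxK trmx_dlsub Bs ur trmx0.
have drs : (drsubmx B)^T = drsubmx B by rewrite trmx_drsub Bs.
have [P' [d' [PP' BP']]] := IH _ drs.
pose K : 'M[R]_(1 + n) := block_mx (1%:M : 'M[R]_1) 0 0 P'.
pose d : 'rV[R]_(1 + n) := row_mx (mu%:M : 'M[R]_1) d'.
have KK : K *m K^T = 1%:M.
  rewrite /K tr_block_mx mulmx_block !trmx0 !trmx1.
  by rewrite !(mulmx0, mul0mx, mulmx1, mul1mx, addr0, add0r) PP' -scalar_mx_block.
have BK : B = K^T *m diag_mx d *m K.
  rewrite /K /d diag_mx_row tr_block_mx !mulmx_block !trmx0 !trmx1.
  rewrite !(mulmx0, mul0mx, mulmx1, mul1mx, addr0, add0r) -BP'.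
  rewrite -[LHS]submxK ul ur dl; congr block_mx.
  by apply/matrixP => i j; rewrite !ord1 !mxE !eqxx.
have AB : A = Q^T *m B0 *m Q.
  by rewrite /B0 !mulmxA QQ' mul1mx -mulmxA QQ' mulmx1.
move: K d KK BK; rewrite /B => {B Bs eB eBi ul ur dl drs BP'}.
change (1 + n)%N with n.+1 => K d KK BK.
exists (K *m Q), d; split.
  by rewrite trmx_mul mulmxA -(mulmxA _ Q) QQ mulmx1.
by rewrite AB BK trmx_mul !mulmxA.
Qed.

End SpectralTheorem.

Section SingularFrame.
Context {R : realType} {m n : nat}.

(* The rows of W are g^-1-orthonormal tangent vectors diagonalising U^T U, for
   g = 1 + U^T U; the nonzero rows of N are the matching normal directions, scaled
   to squared length 1/(1 + lam_i^2), and N vanishes on the kernel of U. *)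
Record singular_frame (U : 'M[R]_(m, n)) (lam : 'I_n -> R)
    (W : 'M[R]_n) (N : 'M[R]_(n, m)) : Prop := SingularFrame {
  frame_ge0 : forall i, 0 <= lam i;
  frame_char : char_poly (U^T *m U) = \prod_(i < n) ('X - (lam i ^+ 2)%:P);
  frame_unit : W \in unitmx;
  frame_inv : invmx (1%:M + U^T *m U) = W^T *m W;
  frame_det : \det (1%:M + U^T *m U) = \prod_i (1 + lam i ^+ 2);
  frame_diag : forall i, (W^T *m W) i i <= 1;
  frame_mul : W *m U^T = diag_mx (\row_i lam i) *m N;
  frame_bessel : forall a : 'cV[R]_m,
    \sum_i (1 + lam i ^+ 2) * (N *m a) i 0 ^+ 2 <= (a^T *m a) 0 0
}.

Lemma singular_frame_exists (U : 'M[R]_(m, n)) :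
  exists lam W N, singular_frame U lam W N.
Proof.
have [P [d [PP UU]]] : exists P : 'M[R]_n, exists d : 'rV[R]_n,
    P *m P^T = 1%:M /\ U^T *m U = P^T *m diag_mx d *m P.
  by apply: symmetric_diagonalization; rewrite trmx_mul trmxK.
have PP' := mulmx1C PP.
have PUU : P *m U^T *m (P *m U^T)^T = diag_mx d.
  rewrite trmx_mul trmxK mulmxA -(mulmxA P) UU !mulmxA PP mul1mx -mulmxA.
  by rewrite PP mulmx1.
have dE i : d 0 i = \sum_j (P *m U^T) i j ^+ 2.
  have := congr1 (fun M : 'M[R]_n => M i i) PUU; rewrite [RHS]mxE eqxx mulr1n => <-.
  rewrite [LHS]mxE; apply: eq_bigr => j _.
  by rewrite [(P *m U^T)^T j i]mxE expr2.
have d0 i : 0 <= d 0 i by rewrite dE sumr_ge0// => j _; exact: sqr_ge0.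
pose lam i := Num.sqrt (d 0 i).
have lam2 i : lam i ^+ 2 = d 0 i by rewrite sqr_sqrtr.
have d1 i : 0 < 1 + d 0 i by rewrite ltr_pwDl.
pose w : 'rV[R]_n := \row_i (Num.sqrt (1 + d 0 i))^-1.
have w2 i : w 0 i * w 0 i = (1 + d 0 i)^-1.
  by rewrite mxE -invfM -expr2 sqr_sqrtr// ltW.
pose W := diag_mx w *m P.
(* Since [0^-1] is 0, a vanishing singular value gives a zero row of N; the matching row of
   [W *m U^T] is zero too ([Y0]), which saves [frame_mul]. *)
pose N := diag_mx (\row_i (lam i)^-1) *m (W *m U^T).
have WW : W^T *m W = P^T *m diag_mx (\row_i (1 + d 0 i)^-1) *m P.
  rewrite /W trmx_mul tr_diag_mx mulmxA -(mulmxA P^T (diag_mx w)) mulmx_diag.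
  by congr (_ *m diag_mx _ *m _); apply/rowP => i; rewrite !mxE -w2 mxE.
have gE : 1%:M + U^T *m U = P^T *m diag_mx (\row_i (1 + d 0 i)) *m P.
  rewrite UU (_ : diag_mx (\row_i (1 + d 0 i)) = 1%:M + diag_mx d).
    by rewrite mulmxDr mulmx1 mulmxDl PP'.
  by apply/matrixP => i j; rewrite !mxE mulrnDl; case: eqP => [->|].
have gWW : (1%:M + U^T *m U) *m (W^T *m W) = 1%:M.
  rewrite gE WW !mulmxA -(mulmxA _ P P^T) PP mulmx1 -(mulmxA P^T) mulmx_diag.
  rewrite (_ : \row_j _ = const_mx 1) ?diag_const_mx ?mulmx1//.
  by apply/rowP => i; rewrite !mxE divff// gt_eqF.
have WPUU : W *m U^T *m (W *m U^T)^T = diag_mx (\row_i (d 0 i / (1 + d 0 i))).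
  rewrite /W -!mulmxA [(_ *m (P *m U^T))^T]trmx_mul tr_diag_mx !mulmxA.
  rewrite -(mulmxA (diag_mx w) P) -(mulmxA (diag_mx w)) PUU !mulmx_diag.
  congr diag_mx; apply/rowP => i; rewrite !mxE -w2 mxE; ring.
pose z := \row_i (lam i)^-1 : 'rV[R]_n.
pose q := \row_i (z 0 i * (d 0 i / (1 + d 0 i)) * z 0 i) : 'rV[R]_n.
have NN : N *m N^T = diag_mx q.
  rewrite /N -/z; move: (W *m U^T) WPUU => Y YY.
  rewrite trmx_mul tr_diag_mx mulmxA -(mulmxA (diag_mx z) Y).
  by rewrite YY !mulmx_diag; congr diag_mx; apply/rowP => j; rewrite !mxE.
have q_le i : q 0 i <= (1 + d 0 i)^-1.
  rewrite !mxE mulrAC mulrA -lam2; set l := lam i.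
  have i0 : 0 <= (1 + l ^+ 2)^-1 by rewrite invr_ge0 lam2 ltW.
  have [->|l0] := eqVneq l 0.
    by rewrite invr0 !mul0r -[0 ^+ 2]/(0 * 0) mulr0 addr0 invr1.
  by rewrite (_ : l^-1 * l^-1 * l ^+ 2 = 1) ?mul1r//; field.
have Y0 i j : lam i = 0 -> (W *m U^T) i j = 0.
  move=> l0; rewrite /W -mulmxA mul_diag_mx mxE; apply/eqP; rewrite mulf_eq0.
  apply/orP; right; have : d 0 i == 0 by rewrite -lam2 l0 expr0n.
  rewrite dE psumr_eq0; last by move=> k _; exact: sqr_ge0.
  by move=> /allP/(_ j (mem_index_enum _)) /=; rewrite sqrf_eq0.
exists lam, W, N; split.
- by move=> i; exact: sqrtr_ge0.
- rewrite UU /char_poly /char_poly_mx.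
  have mpM (k1 k2 k3 : nat) (B : 'M[R]_(k1, k2)) (D : 'M[R]_(k2, k3)) :
    map_mx polyC (B *m D) = map_mx polyC B *m map_mx polyC D by exact: map_mxM.
  have PX : map_mx polyC P^T *m map_mx polyC P = 1%:M by rewrite -mpM PP' map_mx1.
  have -> : 'X%:M - map_mx polyC (P^T *m diag_mx d *m P) =
     map_mx polyC P^T *m ('X%:M - map_mx polyC (diag_mx d)) *m map_mx polyC P.
    by rewrite !mpM mulmxBr mulmxBl mul_mx_scalar -scalemxAl PX scalemx1.
  rewrite !det_mulmx mulrAC -det_mulmx PX det1 mul1r.
  rewrite -/(char_poly_mx (diag_mx d)) -/(char_poly (diag_mx d)).
  rewrite char_poly_trig ?diag_mx_is_trig//.
  by apply: eq_bigr => i _; rewrite mxE eqxx mulr1n lam2.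
- by have [] := mulmx1_unit (etrans (esym (mulmxA _ _ _)) gWW).
- have [gu _] := mulmx1_unit gWW.
  by rewrite -[RHS](mulKmx gu) gWW mulmx1.
- rewrite gE !det_mulmx mulrAC -det_mulmx PP' det1 mul1r det_diag.
  by apply: eq_bigr => i _; rewrite mxE lam2.
- move=> i; have -> : 1 = (P^T *m P) i i by rewrite PP' mxE eqxx.
  rewrite WW -mulmxA mul_diag_mx mxE [leRHS]mxE; apply: ler_sum => j _.
  rewrite !mxE mulrCA ler_piMl -?expr2 ?sqr_ge0//.
  by rewrite invf_le1 ?lerDl.
- rewrite /N; move: (W *m U^T) Y0 => Y Y0.
  apply/matrixP => i j; rewrite !mul_diag_mx !mxE.
  have [l0|l0] := eqVneq (lam i) 0; last by rewrite mulrA divff ?mul1r.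
  by rewrite Y0// l0 mul0r.
(* Bessel's inequality: expand the nonnegative square length of c^T - s N, where s weights b by 1 +
   d. The rows of N are orthogonal with squared lengths q at most 1 / (1 + d). *)
- move=> c; move: N NN => {}N NN; set b := N *m c.
  pose s := \row_i ((1 + d 0 i) * b i 0) : 'rV[R]_n.
  have := mul_trmx_ge0 (c^T - s *m N).
  have -> : (c^T - s *m N) *m (c^T - s *m N)^T =
      c^T *m c - (b^T *m s^T) - s *m b + s *m diag_mx q *m s^T.
    rewrite linearB /= trmxK !trmx_mul mulmxBl !mulmxBr -NN /b.
    by rewrite !mulmxA opprB addrA [LHS]addrAC.
  have addE (B B' : 'M[R]_1) : (B + B') 0 0 = B 0 0 + B' 0 0 by rewrite mxE.
  have oppE (B : 'M[R]_1) : (- B) 0 0 = - B 0 0 by rewrite mxE.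
  rewrite !(addE, oppE).
  have -> : (b^T *m s^T) 0 0 = \sum_i (1 + lam i ^+ 2) * b i 0 ^+ 2.
    by rewrite mxE; apply: eq_bigr => i _; rewrite !mxE lam2; ring.
  have -> : (s *m b) 0 0 = \sum_i (1 + lam i ^+ 2) * b i 0 ^+ 2.
    by rewrite mxE; apply: eq_bigr => i _; rewrite !mxE lam2; ring.
  have : (s *m diag_mx q *m s^T) 0 0 <= \sum_i (1 + lam i ^+ 2) * b i 0 ^+ 2.
    rewrite mul_mx_diag mxE; apply: ler_sum => i _; rewrite [_ 0 i]mxE.
    have -> : s^T i 0 = s 0 i by rewrite mxE.
    rewrite [s 0 i]mxE lam2; have := q_le i; move: (q 0 i) (b i 0) => t k tq.
    rewrite (_ : _ * _ * _ = ((1 + d 0 i) * k) ^+ 2 * t); last by ring.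
    rewrite [leRHS](_ : _ = ((1 + d 0 i) * k) ^+ 2 * (1 + d 0 i)^-1).
      by apply: ler_wpM2l => //; exact: sqr_ge0.
    by field; rewrite gt_eqF.
  by move: (\sum_i _) => S; lra.
Qed.

End SingularFrame.

(** * The second fundamental form of a graph *)

Section GramSum.
Context {R : realType} {m n : nat}.
Implicit Types (B : 'I_n -> 'M[R]_(m, n)) (F : 'M[R]_(m, n) -> 'M[R]_(m, n) -> R).

Definition frame_comb (W : 'M[R]_n) B (r : 'I_n) : 'M[R]_(m, n) :=
  \sum_k W r k *: B k.

(** Trades the contraction of a bilinear form with g^-1 for a sum over an orthonormal frame. *)
Lemma gram_sum (W : 'M[R]_n) B F :
  (forall c X X' Y, F (c *: X + X') Y = c * F X Y + F X' Y) ->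
  (forall c X Y Y', F X (c *: Y + Y') = c * F X Y + F X Y') ->
  \sum_k \sum_l (W^T *m W) k l * F (B k) (B l)
  = \sum_r F (frame_comb W B r) (frame_comb W B r).
Proof.
move=> Fl Fr.
have Fl0 Y : F 0 Y = 0.
  by have := Fl 1 0 0 Y; rewrite scale1r addr0 mul1r; lra.
have Fr0 X : F X 0 = 0.
  by have := Fr 1 X 0 0; rewrite scale1r addr0 mul1r; lra.
have Fls (c : 'I_n -> R) Y : F (\sum_k c k *: B k) Y = \sum_k c k * F (B k) Y.
  by elim/big_rec2 : _ => // k s X _ <-.
have Frs (c : 'I_n -> R) X : F X (\sum_k c k *: B k) = \sum_k c k * F X (B k).
  by elim/big_rec2 : _ => // k s Y _ <-.
under [RHS]eq_bigr => r _.
  rewrite Fls; under eq_bigr do rewrite Frs mulr_sumr.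
  over.
rewrite [RHS]exchange_big; apply: eq_bigr => k _.
rewrite [RHS]exchange_big; apply: eq_bigr => l _.
rewrite mxE mulr_suml; apply: eq_bigr => r _.
by rewrite mxE mulrA.
Qed.

End GramSum.

Section SecondFundamentalForm.
Context {R : realType} {m n : nat}.
Variables (U : 'M[R]_(m, n)) (H : 'I_m -> 'I_n -> 'I_n -> R).
Hypothesis Hsym : forall a i j, H a i j = H a j i.

Let gi := invmx (1%:M + U^T *m U).
(** Here [1%:M - U *m T] is the inverse of 1 + U U^T, the Gram matrix of the natural normal frame of
    the graph; it measures the normal components below. *)
Let T := gi *m U^T.
Definition hess_slice (k : 'I_n) : 'M[R]_(m, n) := \matrix_(a, p) H a k p.
Let B := hess_slice.

(* form_sqnorm is the squared norm of the second fundamental form of the graph and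
   form_grad is |grad ln (sqrt (det g))|^2; for a self-shrinker,
   form_sqnorm + form_cross is the drift Laplacian of ln (sqrt (det g)). *)
Definition form_sqnorm : R := \sum_k \sum_l gi k l *
  \tr (gi *m (B k)^T *m (1%:M - U *m T) *m B l).
Definition form_cross : R := \sum_k \sum_l gi k l * \tr (T *m B k *m (T *m B l)).
Definition form_grad : R := \sum_k \sum_l gi k l * (\tr (T *m B k) * \tr (T *m B l)).

(** The hypothesis says that the shape operators commute, i.e. that the normal bundle is flat.
    Exchanging a and b in the contraction over k and l regroups the trace of a product into a
    product of traces. *)
Lemma form_cross_flat :
  (forall a b p q, \sum_i \sum_j H a q i * gi i j * H b j p
     = \sum_i \sum_j H b q i * gi i j * H a j p) ->
  form_cross = form_grad.
Proof.
move=> flat.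
have trE (X Y : 'M[R]_(n, m)) k l : \tr (X *m B k *m (Y *m B l))
    = \sum_p \sum_q \sum_a \sum_b X p a * Y q b * (H a k q * H b l p).
  rewrite /mxtrace; apply: eq_bigr => p _; rewrite mxE; apply: eq_bigr => q _.
  rewrite !mxE mulr_suml; apply: eq_bigr => a _; rewrite mulr_sumr.
  by apply: eq_bigr => b _; rewrite !mxE; ring.
have trE' k l : \tr (T *m B k) * \tr (T *m B l)
    = \sum_p \sum_q \sum_a \sum_b T p a * T q b * (H a k p * H b l q).
  rewrite /mxtrace mulr_suml; apply: eq_bigr => p _; rewrite mulr_sumr.
  apply: eq_bigr => q _; rewrite !mxE mulr_suml; apply: eq_bigr => a _.
  by rewrite mulr_sumr; apply: eq_bigr => b _; rewrite !mxE; ring.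
have pull (F : 'I_n -> 'I_n -> 'I_n -> 'I_n -> 'I_m -> 'I_m -> R) :
    \sum_k \sum_l gi k l * (\sum_p \sum_q \sum_a \sum_b F k l p q a b)
    = \sum_p \sum_q \sum_a \sum_b \sum_k \sum_l gi k l * F k l p q a b.
  under eq_bigr do under eq_bigr do rewrite mulr_sumr.
  under eq_bigr do rewrite exchange_big.
  rewrite exchange_big; apply: eq_bigr => p _.
  under eq_bigr do under eq_bigr do rewrite mulr_sumr.
  under eq_bigr do rewrite exchange_big.
  rewrite exchange_big; apply: eq_bigr => q _.
  under eq_bigr do under eq_bigr do rewrite mulr_sumr.
  under eq_bigr do rewrite exchange_big.
  rewrite exchange_big; apply: eq_bigr => a _.
  under eq_bigr do under eq_bigr do rewrite mulr_sumr.
  under eq_bigr do rewrite exchange_big.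
  by rewrite exchange_big.
rewrite /form_cross /form_grad.
under eq_bigr do under eq_bigr do rewrite trE.
under [RHS]eq_bigr do under eq_bigr do rewrite trE'.
rewrite !pull; apply: eq_bigr => p _; apply: eq_bigr => q _.
apply: eq_bigr => a _; apply: eq_bigr => b _.
transitivity (T p a * T q b * \sum_k \sum_l H a q k * gi k l * H b l p).
  rewrite mulr_sumr; apply: eq_bigr => k _; rewrite mulr_sumr.
  by apply: eq_bigr => l _; rewrite (Hsym a k); ring.
rewrite flat mulr_sumr [RHS]exchange_big; apply: eq_bigr => k _; rewrite mulr_sumr.
have gis : gi^T = gi by rewrite /gi trmx_inv linearD /= trmx1 trmx_mul trmxK.
have gilk k' l : gi k' l = gi l k' by rewrite -{1}gis mxE.
by apply: eq_bigr => l _; rewrite (Hsym b q) (gilk k); ring.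
Qed.

Section InFrame.
Variables (lam : 'I_n -> R) (W : 'M[R]_n) (N : 'M[R]_(n, m)).
Hypothesis frame : singular_frame U lam W N.

Let C := frame_comb W B.
Definition frame_tensor (i j r : 'I_n) : R := (N *m (C r *m W^T)) i j.
Let h := frame_tensor.

Lemma frame_tensor_sym i j k : h i j k = h i k j.
Proof.
have E a b : h i a b = \sum_c \sum_p \sum_k N i c * W a p * W b k * H c k p.
  rewrite /h /frame_tensor mxE; apply: eq_bigr => c _.
  rewrite mxE mulr_sumr; apply: eq_bigr => p _.
  rewrite summxE mulr_suml mulr_sumr; apply: eq_bigr => l _.
  by rewrite !mxE; ring.
rewrite !E; apply: eq_bigr => c _; rewrite exchange_big.
by apply: eq_bigr => p _; apply: eq_bigr => l _; rewrite (Hsym c); ring.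
Qed.

Let giE : gi = W^T *m W. Proof. exact: frame_inv frame. Qed.

Let L := diag_mx (\row_i lam i).

Let TE : T = W^T *m (L *m N).
Proof. by rewrite /T giE -mulmxA (frame_mul frame). Qed.

Let LE (X : 'M[R]_n) i j : (L *m X) i j = lam i * X i j.
Proof. by rewrite /L mul_diag_mx !mxE. Qed.

Let TC r : T *m C r = W^T *m (L *m (N *m C r)).
Proof. by rewrite TE !mulmxA. Qed.

Lemma form_crossE : form_cross = cross3 lam h.
Proof.
rewrite /form_cross giE (@gram_sum _ _ _ W B (fun X Y => \tr (T *m X *m (T *m Y)))).
- have -> : cross3 lam h = \sum_r \sum_i \sum_j lam i * lam j * (h i j r * h j i r).
    rewrite /cross3 [RHS]exchange_big; apply: eq_bigr => i _.
    by rewrite [RHS]exchange_big.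
  apply: eq_bigr => r _; rewrite -/(C r) TC.
  have -> : W^T *m (L *m (N *m C r)) *m (W^T *m (L *m (N *m C r)))
     = W^T *m (L *m (N *m C r) *m (W^T *m (L *m (N *m C r)))) by rewrite !mulmxA.
  rewrite mxtrace_mulC.
  have -> : L *m (N *m C r) *m (W^T *m (L *m (N *m C r))) *m W^T
     = L *m (N *m (C r *m W^T)) *m (L *m (N *m (C r *m W^T))) by rewrite !mulmxA.
  rewrite /mxtrace; apply: eq_bigr => i _; rewrite mxE; apply: eq_bigr => j _.
  by rewrite !LE /h /frame_tensor; ring.
- move=> c X X' Y; rewrite mulmxDr mulmxDl -scalemxAr -scalemxAl.
  by rewrite mxtraceD mxtraceZ.
- move=> c X Y Y'; rewrite !mulmxDr -!scalemxAr.
  by rewrite mxtraceD mxtraceZ.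
Qed.

Lemma form_gradE : form_grad = trace3 lam h.
Proof.
rewrite /form_grad giE (@gram_sum _ _ _ W B (fun X Y => \tr (T *m X) * \tr (T *m Y))).
- apply: eq_bigr => r _; rewrite -/(C r) TC mxtrace_mulC -!mulmxA -expr2.
  congr (_ ^+ 2); rewrite /mxtrace; apply: eq_bigr => i _.
  by rewrite LE /h /frame_tensor mulmxA.
- by move=> c X X' Y; rewrite mulmxDr -scalemxAr mxtraceD mxtraceZ; ring.
- by move=> c X Y Y'; rewrite mulmxDr -scalemxAr mxtraceD mxtraceZ; ring.
Qed.

Let Z r := C r *m W^T.

(** In the frame [U *m T] becomes the Gram matrix [(L *m N)^T *m (L *m N)], so the normal metric
    only subtracts the matched components weighted by lam. *)
Lemma form_sqnormE : form_sqnorm =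
  \sum_r \sum_j (\sum_a Z r a j ^+ 2 - \sum_i (lam i * h i j r) ^+ 2).
Proof.
have -> : form_sqnorm = \sum_k \sum_l (W^T *m W) k l *
    \tr (gi *m (B k)^T *m (1%:M - U *m T) *m B l) by rewrite -giE.
rewrite (@gram_sum _ _ _ W B (fun X Y => \tr (gi *m X^T *m (1%:M - U *m T) *m Y))).
- apply: eq_bigr => r _; rewrite -/(C r).
  have UT : U *m T = (L *m N)^T *m (L *m N).
    by rewrite -(frame_mul frame) trmx_mul trmxK TE -(frame_mul frame) !mulmxA.
  have -> : gi *m (C r)^T *m (1%:M - U *m T) *m C r =
      W^T *m (W *m (C r)^T *m (1%:M - U *m T) *m C r) by rewrite giE !mulmxA.
  rewrite mxtrace_mulC UT mulmxBr !mulmxBl mulmx1.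
  have -> : W *m (C r)^T *m C r *m W^T = (Z r)^T *m Z r.
    by rewrite /Z trmx_mul trmxK !mulmxA.
  have -> : W *m (C r)^T *m ((L *m N)^T *m (L *m N)) *m C r *m W^T
      = (L *m (N *m Z r))^T *m (L *m (N *m Z r)).
    by rewrite /Z !trmx_mul trmxK !mulmxA.
  rewrite linearB /= /mxtrace -sumrB; apply: eq_bigr => j _; rewrite !mxE.
  congr (_ - _); apply: eq_bigr => a _; rewrite ![_^T j a]mxE; first by rewrite expr2.
  by rewrite LE expr2.
- move=> c X X' Y; move: (1%:M - U *m T) => G.
  rewrite [(_ + _)^T]linearD /= linearZ /= mulmxDr !mulmxDl.
  by rewrite -scalemxAr -!scalemxAl mxtraceD mxtraceZ.
- by move=> c X Y Y'; rewrite mulmxDr -scalemxAr mxtraceD mxtraceZ.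
Qed.

(** [frame_bessel], applied to each column of [Z r], gives room for the subtracted lam^2 h^2 with
    h^2 to spare. The inequality can be strict, as h does not see normal directions outside the row
    space of N. *)
Lemma form_sqnorm_ge : sqnorm3 h <= form_sqnorm.
Proof.
have -> : sqnorm3 h = \sum_r \sum_j \sum_i h i j r ^+ 2.
  rewrite /sqnorm3 [RHS]exchange_big; under [RHS]eq_bigr do rewrite exchange_big.
  by rewrite [RHS]exchange_big.
rewrite form_sqnormE; apply: ler_sum => r _; apply: ler_sum => j _.
have := frame_bessel frame (col j (Z r)); rewrite [leRHS]mxE.
have -> : \sum_a (col j (Z r))^T 0 a * col j (Z r) a 0 = \sum_a Z r a j ^+ 2.
  by apply: eq_bigr => a _; rewrite !mxE expr2.
have -> : \sum_i (1 + lam i ^+ 2) * (N *m col j (Z r)) i 0 ^+ 2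
    = \sum_i h i j r ^+ 2 + \sum_i (lam i * h i j r) ^+ 2.
  rewrite -big_split; apply: eq_bigr => i _; rewrite colE mulmxA -colE mxE.
  by rewrite /h /frame_tensor -/(Z r) /=; ring.
by rewrite lerBrDr.
Qed.

(** The matched components alone do not determine H. Once they vanish, [form_sqnorm] is the full
    square sum of the [Z r], and invertibility of W recovers H. *)
Lemma form_sqnorm_eq0 : (forall i j r, h i j r = 0) -> form_sqnorm <= 0 ->
  forall a i j, H a i j = 0.
Proof.
move=> h0; rewrite form_sqnormE => Z_le.
have Z0 r : Z r = 0.
  apply/matrixP => c j; rewrite [RHS]mxE; apply/eqP; rewrite -sqrf_eq0.
  apply/eqP; apply: (sum3_eq0 (F := fun r j a => Z r a j ^+ 2)) => [*|].
    exact: sqr_ge0.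
  apply: le_trans Z_le; apply: ler_sum => r' _; apply: ler_sum => j' _.
  rewrite [X in _ - X]big1 ?subr0// => i _; by rewrite h0 mulr0 expr0n.
have C0 r : C r = 0.
  have WuT : W^T \in unitmx by rewrite unitmx_tr (frame_unit frame).
  by rewrite -(mulmxK WuT (C r)) -/(Z r) Z0 mul0mx.
move=> a i j; have := frame_unit frame => Wu.
have -> : H a i j = \sum_k (1%:M : 'M[R]_n) i k * H a k j.
  rewrite (bigD1 i)//= mxE eqxx mul1r big1 ?addr0// => k ki.
  by rewrite mxE eq_sym (negbTE ki) mul0r.
rewrite -(mulVmx Wu).
have -> : \sum_k (invmx W *m W) i k * H a k j =
   \sum_r invmx W i r * (C r) a j.
  under [RHS]eq_bigr do rewrite summxE mulr_sumr.
  rewrite [RHS]exchange_big; apply: eq_bigr => k _; rewrite mxE mulr_suml.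
  by apply: eq_bigr => r _; rewrite !mxE mulrA.
by apply: big1 => r _; rewrite C0 mxE mulr0.
Qed.

End InFrame.
End SecondFundamentalForm.

(** * Positivity of the form under each of the three assumptions *)

Section PointwisePositivity.
Context {R : realType} {m n : nat}.
Variables (U : 'M[R]_(m, n)) (H : 'I_m -> 'I_n -> 'I_n -> R).
Hypothesis Hsym : forall a i j, H a i j = H a j i.

(** For s = 2k, Q is the bracket in L (det g)^k; the second half is the rigidity that makes the
    graph flat once L annihilates that function. *)
Definition positive_form (s : R) : Prop :=
  let Q := form_sqnorm U H + form_cross U H + s * form_grad U H in
  0 <= Q /\ (Q <= 0 -> forall a i j, H a i j = 0).

Let positive_form_tensor s lam W N (fr : singular_frame U lam W N) :
  let h := frame_tensor H W N in
  0 <= sqnorm3 h + cross3 lam h + s * trace3 lam h ->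
  (sqnorm3 h + cross3 lam h + s * trace3 lam h <= 0 -> sqnorm3 h <= 0) ->
  positive_form s.
Proof.
move=> h Q0 Qh; rewrite /positive_form (form_crossE H fr) (form_gradE H fr).
have := form_sqnorm_ge H fr; rewrite -/h => A2; split; first lra.
move=> Q_le; have h2 : sqnorm3 h <= 0 by apply: Qh; lra.
apply: (form_sqnorm_eq0 fr); first exact: sqnorm3_eq0.
have := sqnorm3_ge0 h; lra.
Qed.

Lemma positive_form_contracting :
  (forall lam, singular_values U lam -> forall i j, i <> j -> lam i * lam j <= 1) ->
  positive_form (- n%:R^-1).
Proof.
move=> le1; have [lam [W [N fr]]] := singular_frame_exists U.
have lam0 := frame_ge0 fr.
have lam1 i j : i != j -> lam i * lam j <= 1.
  by move=> /eqP ij; apply: (le1 lam) => //; split=> //; exact: frame_char fr.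
have hs := frame_tensor_sym Hsym W N.
apply: (positive_form_tensor fr); rewrite mulNr.
  exact: contracting_tensor_ge0.
move=> /(contracting_tensor_eq0 hs lam0 lam1) h0.
by rewrite /sqnorm3 big1// => i _; rewrite big1// => j _; rewrite big1// => k _;
  rewrite h0 expr0n.
Qed.

(** With the cross term equal to the gradient term, the form is |A|^2 plus 1 - 1/n times the
    gradient term. *)
Lemma positive_form_flat :
  (forall a b p q,
     \sum_i \sum_j H a q i * invmx (1%:M + U^T *m U) i j * H b j p
     = \sum_i \sum_j H b q i * invmx (1%:M + U^T *m U) i j * H a j p) ->
  positive_form (- n%:R^-1).
Proof.
move=> flat; have [lam [W [N fr]]] := singular_frame_exists U.
have E := form_cross_flat Hsym flat.
rewrite /positive_form E.
have D0 : 0 <= form_grad U H by rewrite (form_gradE H fr) trace3_ge0.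
have n1 : (n%:R : R)^-1 <= 1.
  case: n => [|k]; first by rewrite invr0.
  by rewrite invf_le1 ?ltr0n// ler1n.
have nD : n%:R^-1 * form_grad U H <= form_grad U H by rewrite ler_piMl.
have A2 := form_sqnorm_ge H fr.
have h0 := sqnorm3_ge0 (frame_tensor H W N).
split; first lra.
move=> Q_le; apply: (form_sqnorm_eq0 fr); last lra.
by apply: sqnorm3_eq0; lra.
Qed.

Let prod_scale (x : 'I_n -> R) : (forall i, 0 <= x i) -> \prod_i (1 + x i) < 9 ->
  exists2 t : R, 1 < t & \prod_i (1 + t * x i) <= 9.
Proof.
move=> x0; set p := \prod_i (1 + x i) => p9.
have p0 : 0 < p by apply: prodr_gt0 => i _; rewrite ltr_pwDl.
(* So t^(n+1) = 9 / p; dividing by n + 1 instead of n keeps the quotient meaningful for n = 0, and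
   t^n <= 9 / p suffices because each factor grows at most by t. *)
pose c := ln (9 / p) / n.+1%:R; pose t := expR c.
have l0 : 0 < ln (9 / p) by rewrite ln_gt0// ltr_pdivlMr// mul1r.
have c0 : 0 < c by rewrite divr_gt0 ?ltr0n.
have t1 : 1 < t by rewrite -expR0 ltr_expR.
exists t => //.
have tn : t ^+ n <= 9 / p.
  rewrite /t -expRM_natl -[leRHS]lnK ?posrE ?divr_gt0// ler_expR.
  rewrite /c mulrCA; apply: ler_piMr; first exact: ltW.
  by rewrite ler_pdivrMr ?ltr0n// mul1r ler_nat.
apply: (@le_trans _ _ (\prod_(i < n) (t * (1 + x i)))).
  apply: ler_prod => i _; rewrite addr_ge0 ?mulr_ge0//=; last first.
    by rewrite ltW// (lt_trans ltr01).
  by rewrite mulrDr mulr1 lerD2r ltW.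
rewrite big_split /= prodr_const card_ord -/p.
by rewrite -ler_pdivlMr.
Qed.

(* Strict positivity comes from the slack in det g < 9: the nonstrict inequality
   still holds after multiplying all the lam_i by a factor larger than 1. *)
Lemma positive_form_small_det : \det (1%:M + U^T *m U) < 9 -> positive_form 2.
Proof.
have [lam [W [N fr]]] := singular_frame_exists U; rewrite (frame_det fr) => det9.
have [t t1 t9] := prod_scale (fun i => sqr_ge0 (lam i)) det9.
have t0 : 0 <= t by lra.
pose mu i := Num.sqrt t * lam i.
have mu0 i : 0 <= mu i by rewrite mulr_ge0 ?sqrtr_ge0 ?(frame_ge0 fr).
have mu9 : \prod_i (1 + mu i ^+ 2) <= 9.
  by under eq_bigr do rewrite exprMn sqr_sqrtr//.
set h := frame_tensor H W N.
have hs : forall i j k, h i j k = h i k j := frame_tensor_sym Hsym W N.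
have := small_product_tensor_ge0 mu0 mu9 hs.
have -> : cross3 mu h = t * cross3 lam h.
  rewrite /cross3 mulr_sumr; apply: eq_bigr => i _; rewrite mulr_sumr.
  apply: eq_bigr => j _; rewrite mulr_sumr; apply: eq_bigr => k _.
  by rewrite /mu; move: (Num.sqrt t) (sqr_sqrtr t0) => s <-; ring.
have -> : trace3 mu h = t * trace3 lam h.
  rewrite /trace3 mulr_sumr; apply: eq_bigr => k _.
  rewrite /mu; move: (Num.sqrt t) (sqr_sqrtr t0) => s <-.
  by rewrite -exprMn mulr_sumr; congr (_ ^+ 2); apply: eq_bigr => i _; rewrite mulrA.
have h0 := sqnorm3_ge0 h.
set X := sqnorm3 h in h0 *; set Y := cross3 lam h; set Z := trace3 lam h.
(* The cross and trace terms are quadratic in lam, so they scale by t while X does not; the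
   difference (t - 1) X is the strict gain. *)
move=> tpos; have step : 0 <= t * (X + Y + 2 * Z) - (t - 1) * X by lra.
have tX : 0 <= (t - 1) * X by rewrite mulr_ge0// subr_ge0 ltW.
apply: (positive_form_tensor fr); rewrite -/h -/X -/Y -/Z.
  by rewrite -(pmulr_rge0 _ (lt_trans ltr01 t1)); lra.
move=> Qle; have : t * (X + Y + 2 * Z) <= 0 by rewrite mulr_ge0_le0.
move=> tQ; rewrite -(pmulr_rle0 _ (_ : 0 < t - 1)) ?subr_gt0//; lra.
Qed.

End PointwisePositivity.

(** * Matrix calculus *)

Section MatrixCalculus.
Context {R : realType} {n : nat}.
Implicit Types (x : 'rV[R]_n) (k : 'I_n).

Definition Ckmx l p q (A : 'rV[R]_n -> 'M[R]_(p, q)) : Prop :=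
  forall i j, Ck l (fun y => A y i j).

Definition mpartial p q k (A : 'rV[R]_n -> 'M[R]_(p, q)) x : 'M[R]_(p, q) :=
  \matrix_(i, j) partial k (fun y => A y i j) x.

Lemma Ckmx_mul l p q r (A : 'rV[R]_n -> 'M[R]_(p, q)) (B : 'rV[R]_n -> 'M[R]_(q, r)) :
  Ckmx l A -> Ckmx l B -> Ckmx l (fun y => A y *m B y).
Proof.
move=> CA CB i j.
rewrite (_ : (fun y => _) = fun y => \sum_s A y i s * B y s j).
  by apply: Ck_sum => s; exact: CkM.
by apply/funext => y; rewrite mxE.
Qed.

Lemma Ckmx_tr l p q (A : 'rV[R]_n -> 'M[R]_(p, q)) :
  Ckmx l A -> Ckmx l (fun y => (A y)^T).
Proof.
move=> CA i j; rewrite (_ : (fun y => _) = fun y => A y j i); first exact: CA.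
by apply/funext => y; rewrite mxE.
Qed.

Lemma mpartial_mul p q r k (A : 'rV[R]_n -> 'M[R]_(p, q))
    (B : 'rV[R]_n -> 'M[R]_(q, r)) x : Ckmx 1 A -> Ckmx 1 B ->
  mpartial k (fun y => A y *m B y) x
  = mpartial k A x *m B x + A x *m mpartial k B x.
Proof.
move=> CA CB; apply/matrixP => i j; rewrite [LHS]mxE.
rewrite (_ : (fun y => _) = fun y => \sum_s A y i s * B y s j); last first.
  by apply/funext => y; rewrite mxE.
rewrite partial_sum; last by move=> s; exact: CkM.
rewrite [RHS]mxE [X in _ = X + _]mxE [X in _ = _ + X]mxE -big_split /=.
apply: eq_bigr => s _.
rewrite (partialM (Ck_derivable (CA i s) k x) (Ck_derivable (CB s j) k x)).
by rewrite [mpartial k A x i s]mxE [mpartial k B x s j]mxE.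
Qed.

Lemma mpartial_tr p q k (A : 'rV[R]_n -> 'M[R]_(p, q)) x :
  mpartial k (fun y => (A y)^T) x = (mpartial k A x)^T.
Proof.
apply/matrixP => i j; rewrite [LHS]mxE [RHS]mxE [RHS]mxE; congr partial.
by apply/funext => y; rewrite mxE.
Qed.

Lemma mpartial_cst p q k (A : 'M[R]_(p, q)) x : mpartial k (fun=> A) x = 0.
Proof. by apply/matrixP => i j; rewrite !mxE partial_cst. Qed.

Lemma partial_mxtrace p k (A : 'rV[R]_n -> 'M[R]_p) x : Ckmx 1 A ->
  partial k (fun y => \tr (A y)) x = \tr (mpartial k A x).
Proof.
move=> CA; rewrite /mxtrace partial_sum; last by move=> i; exact: CA.
by apply: eq_bigr => i _; rewrite mxE.
Qed.

Lemma Ck_mxtrace l p (A : 'rV[R]_n -> 'M[R]_p) :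
  Ckmx l A -> Ck l (fun y => \tr (A y)).
Proof. by move=> CA; apply: Ck_sum => i; exact: CA. Qed.

Lemma partial_prod_ord p k (F : 'I_p -> 'rV[R]_n -> R) x :
  (forall i, Ck 1 (F i)) ->
  partial k (fun y => \prod_i F i y) x
  = \sum_i \prod_j (if j == i then partial k (F j) x else F j x).
Proof.
elim: p F => [|p IH] F CF.
  rewrite big_ord0 (_ : (fun y => _) = fun=> 1) ?partial_cst//.
  by apply/funext => y; rewrite big_ord0.
rewrite (_ : (fun y => _) = fun y => F ord0 y * \prod_i F (lift ord0 i) y); last first.
  by apply/funext => y; rewrite big_ord_recl.
have CP : Ck 1 (fun y => \prod_i F (lift ord0 i) y) by apply: Ck_prod => i.
rewrite (partialM (Ck_derivable (CF ord0) k x) (Ck_derivable CP k x)).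
rewrite IH// big_ord_recl /=; congr (_ + _).
  by rewrite big_ord_recl /=.
rewrite mulr_sumr; apply: eq_bigr => i _.
rewrite big_ord_recl /=; congr (_ * _); apply: eq_bigr => j _.

Qed.

Lemma Ck_det l p (A : 'rV[R]_n -> 'M[R]_p) : Ckmx l A -> Ck l (fun y => \det (A y)).
Proof.
move=> CA; apply: Ck_sum => s; apply: CkZ; apply: Ck_prod => i; exact: CA.
Qed.

(** Jacobi's formula: the product rule gives a sum of determinants with one row differentiated, each
    expanded along that row. *)
Lemma partial_det p k (A : 'rV[R]_n -> 'M[R]_p) x : Ckmx 1 A ->
  partial k (fun y => \det (A y)) x = \tr (\adj (A x) *m mpartial k A x).
Proof.
move=> CA; have CP s : Ck 1 (fun y => \prod_(i < p) A y i (perm.fun_of_perm s i)).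
  by apply: Ck_prod => i; exact: CA.
rewrite [in LHS]/determinant partial_sum; last by move=> s; exact: CkZ.
pose D := mpartial k A x.
pose M i : 'M[R]_p := \matrix_(a, b) (if a == i then D a b else A x a b).
transitivity (\sum_i \det (M i)).
  rewrite /determinant exchange_big; apply: eq_bigr => s _.
  rewrite (partialZ _ (Ck_derivable (CP s) k x)) -mulr_sumr; congr (_ * _).
  rewrite partial_prod_ord; last by move=> i; exact: CA.
  apply: eq_bigr => i _; apply: eq_bigr => j _; rewrite [RHS]mxE.
  by case: eqP => // _; rewrite mxE.
transitivity (\sum_i \sum_j D i j * cofactor (A x) i j).
  apply: eq_bigr => i _; rewrite (expand_det_row _ i); apply: eq_bigr => j _.
  rewrite mxE eqxx; congr (_ * (_ * \det _)); apply/matrixP => a b.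
  by rewrite !mxE eq_sym (negbTE (neq_lift i a)).
rewrite /mxtrace exchange_big; apply: eq_bigr => j _; rewrite mxE.
by apply: eq_bigr => i _; rewrite [(\adj _) _ _]mxE mulrC.
Qed.

Lemma Ckmx_inv l p (A : 'rV[R]_n -> 'M[R]_p) : (forall y, \det (A y) != 0) ->
  Ckmx l A -> Ckmx l (fun y => invmx (A y)).
Proof.
move=> A0 CA i j.
rewrite (_ : (fun y => _) = fun y => (\det (A y))^-1 *
    ((-1) ^+ (j + i) * \det (row' j (col' i (A y))))).
  apply: CkM; first by apply: CkV => //; exact: Ck_det.
  apply: CkZ; apply: Ck_det => a b.
  rewrite (_ : (fun y => _) = fun y => A y (lift j a) (lift i b)); first exact: CA.
  by apply/funext => y; rewrite !mxE.
apply/funext => y; rewrite /invmx unitmxE unitfE A0.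
by rewrite mxE [(\adj _) _ _]mxE.
Qed.

Lemma mpartial_inv p k (A : 'rV[R]_n -> 'M[R]_p) x : (forall y, \det (A y) != 0) ->
  Ckmx 1 A ->
  mpartial k (fun y => invmx (A y)) x
  = - (invmx (A x) *m mpartial k A x *m invmx (A x)).
Proof.
move=> A0 CA; have Au y : A y \in unitmx by rewrite unitmxE unitfE A0.
have := mpartial_mul k x CA (Ckmx_inv A0 CA).
rewrite (_ : (fun y => _) = fun=> 1%:M); last by apply/funext => y; rewrite mulmxV.
rewrite mpartial_cst => /esym/eqP; rewrite addrC addr_eq0 => /eqP E.
by rewrite -[LHS](mulKmx (Au x)) E mulmxN mulmxA.
Qed.

Lemma partial_ln_det p k (A : 'rV[R]_n -> 'M[R]_p) x : (forall y, 0 < \det (A y)) ->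
  Ckmx 1 A ->
  partial k (fun y => ln (\det (A y))) x = \tr (invmx (A x) *m mpartial k A x).
Proof.
move=> A0 CA; rewrite (partial_ln (A0 x) (Ck_derivable (Ck_det CA) k x)).
rewrite (partial_det _ _ CA) /invmx unitmxE unitfE gt_eqF//=.
by rewrite -scalemxAl mxtraceZ.
Qed.

End MatrixCalculus.

(** * The self-shrinking system *)

Lemma exchange_sum3 (R : nmodType) (I J K : finType) (F : I -> J -> K -> R) :
  \sum_i \sum_j \sum_k F i j k = \sum_k \sum_i \sum_j F i j k.
Proof. by under eq_bigr do rewrite exchange_big; rewrite exchange_big. Qed.

Section CrossTerm.
Context {R : realType} {m n : nat}.
Variables (U : 'M[R]_(m, n)) (H : 'I_m -> 'I_n -> 'I_n -> R).
Hypothesis Hsym : forall a i j, H a i j = H a j i.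
Let gi := invmx (1%:M + U^T *m U).
Let T := gi *m U^T.
Let B := hess_slice H.

Lemma inv_metric_sym : gi^T = gi.
Proof. by rewrite /gi trmx_inv linearD /= trmx1 trmx_mul trmxK. Qed.

(** The left side is what the derivative of g^{ij} contributes when the system is differentiated.
    Its two summands are transposes of each other and contribute equally. *)
Lemma form_cross_third :
  \sum_p \sum_a T p a * (\sum_i \sum_j
    (gi *m ((B p)^T *m U + U^T *m B p) *m gi) i j * H a i j) = 2 * form_cross U H.
Proof.
have giC i j : gi i j = gi j i by rewrite -{1}inv_metric_sym mxE.
have swap p a : \sum_i \sum_j (gi *m ((B p)^T *m U + U^T *m B p) *m gi) i j * H a i j
    = 2 * \sum_i \sum_j (T *m B p *m gi) i j * H a i j.
  have -> : gi *m ((B p)^T *m U + U^T *m B p) *m gi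
      = (T *m B p *m gi)^T + T *m B p *m gi.
    rewrite mulmxDr mulmxDl /T; congr (_ + _); last by rewrite !mulmxA.
    by rewrite !trmx_mul trmxK inv_metric_sym !mulmxA.
  have -> (X : 'M[R]_n) : \sum_i \sum_j (X^T + X) i j * H a i j =
      \sum_i \sum_j X^T i j * H a i j + \sum_i \sum_j X i j * H a i j.
    rewrite -big_split; apply: eq_bigr => i _; rewrite -big_split.
    by apply: eq_bigr => j _; rewrite mxE mulrDl.
  rewrite mulr_natl mulr2n; congr (_ + _); rewrite exchange_big.
  by apply: eq_bigr => i _; apply: eq_bigr => j _; rewrite mxE Hsym.
under eq_bigr do under eq_bigr do rewrite swap mulrCA.
under eq_bigr do rewrite -mulr_sumr.
rewrite -mulr_sumr; congr (2 * _).
transitivity (\sum_p \sum_a \sum_i \sum_j \sum_b \sum_q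
    T p a * T i b * (H b p q * gi q j * H a i j)).
  apply: eq_bigr => p _; apply: eq_bigr => a _.
  rewrite mulr_sumr; apply: eq_bigr => i _; rewrite mulr_sumr.
  apply: eq_bigr => j _; rewrite -mulmxA [(_ *m (_ *m _)) i j]mxE mulr_suml mulr_sumr.
  apply: eq_bigr => b _; rewrite [(B p *m gi) b j]mxE mulr_sumr mulr_suml mulr_sumr.
  by apply: eq_bigr => q _; rewrite [B p b q]mxE; ring.
rewrite /form_cross.
transitivity (\sum_k \sum_l \sum_p \sum_q \sum_a \sum_b
    T p a * T q b * (gi k l * (H a k q * H b l p))); last first.
  apply: eq_bigr => k _; apply: eq_bigr => l _.
  rewrite /mxtrace mulr_sumr; apply: eq_bigr => p _.
  rewrite -/gi -/T -/B [(_ *m _) p p]mxE mulr_sumr; apply: eq_bigr => q _.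
  rewrite [(T *m B k) p q]mxE mulr_suml mulr_sumr; apply: eq_bigr => a _.
  rewrite [(T *m B l) q p]mxE 2!mulr_sumr; apply: eq_bigr => b _.
  by rewrite [B k a q]mxE [B l b p]mxE; ring.
rewrite [RHS]exchange_sum3; apply: eq_bigr => p _.
rewrite [RHS]exchange_sum3; under [RHS]eq_bigr do rewrite exchange_sum3.
rewrite [RHS]exchange_big; apply: eq_bigr => a _; apply: eq_bigr => i _.
apply: eq_bigr => j _; rewrite [RHS]exchange_big; apply: eq_bigr => b _.
by apply: eq_bigr => q _; rewrite (giC j) (Hsym a j) (Hsym b q); ring.
Qed.

End CrossTerm.

Section SmoothGraph.
Context {R : realType} {n m : nat}.
Variable u : 'rV[R]_n -> 'rV[R]_m.
Hypothesis u_smooth : smooth_map u.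
Implicit Types (x : 'rV[R]_n) (k : 'I_n).

Let U := diff_mx u.
Let gi := inv_metric u.
Let T x := gi x *m (U x)^T.
Definition hessian x (a : 'I_m) (i j : 'I_n) : R := d2 u a i j x.
Let B k x := hess_slice (hessian x) k.

Lemma metricE x : metric u x = 1%:M + (U x)^T *m U x.
Proof.
apply/matrixP => i j; rewrite !mxE; congr (_ + _).
by apply: eq_bigr => a _; rewrite !mxE.
Qed.

Let giE x : gi x = invmx (1%:M + (U x)^T *m U x).
Proof. by rewrite /gi /inv_metric metricE. Qed.

Lemma hessian_sym x a i j : hessian x a i j = hessian x a j i.
Proof. exact: schwarz (u_smooth 2 a). Qed.

Lemma Ckmx_diff_mx l : Ckmx l U.
Proof.
move=> a i; rewrite (_ : (fun y => _) = partial i (component u a)).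
  exact: Ck_partial (u_smooth l.+1 a) i.
by apply/funext => y; rewrite mxE.
Qed.

Lemma Ckmx_hess_slice l k : Ckmx l (B k).
Proof.
move=> a p; rewrite (_ : (fun y => _) = partial k (partial p (component u a))).
  exact: Ck_partial (Ck_partial (u_smooth l.+2 a) p) k.
by apply/funext => y; rewrite mxE.
Qed.

Let CUU l : Ckmx l (fun y => (U y)^T *m U y).
Proof. by apply: Ckmx_mul; [apply: Ckmx_tr|]; exact: Ckmx_diff_mx. Qed.

Let metric_entry i j :
  (fun y => metric u y i j) = fun y => (i == j)%:R + ((U y)^T *m U y) i j.
Proof. by apply/funext => y; rewrite metricE mxE [1%:M i j]mxE. Qed.

Lemma Ckmx_metric l : Ckmx l (metric u).
Proof.
move=> i j; rewrite metric_entry; apply: CkD; first exact: Ck_cst.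
exact: CUU.
Qed.

Lemma det_metric_gt0 x : 0 < \det (metric u x).
Proof.
have [lam [W [N fr]]] := singular_frame_exists (U x).
rewrite metricE (frame_det fr); apply: prodr_gt0 => i _.
by rewrite ltr_pwDl ?sqr_ge0.
Qed.

Let det_metric_neq0 x : \det (metric u x) != 0.
Proof. by rewrite gt_eqF ?det_metric_gt0. Qed.

Lemma Ckmx_inv_metric l : Ckmx l gi.
Proof. exact: Ckmx_inv det_metric_neq0 (Ckmx_metric l). Qed.

Lemma inv_metric_positive : positive_coefficients gi.
Proof.
move=> x; have [lam [W [N fr]]] := singular_frame_exists (U x).
by exists W; [exact: frame_unit fr|rewrite giE (frame_inv fr)].
Qed.

Lemma inv_metric_diag x i : gi x i i <= 1.
Proof.
have [lam [W [N fr]]] := singular_frame_exists (U x).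
by rewrite giE (frame_inv fr); exact: frame_diag fr i.
Qed.

Let mpartial_U k x : mpartial k U x = B k x.
Proof.
apply/matrixP => a p; rewrite [LHS]mxE [RHS]mxE /hessian /d2; congr partial.
by apply/funext => y; rewrite mxE.
Qed.

Lemma mpartial_metric k x :
  mpartial k (metric u) x = (B k x)^T *m U x + (U x)^T *m B k x.
Proof.
have <- : mpartial k (fun y => (U y)^T *m U y) x =
    (B k x)^T *m U x + (U x)^T *m B k x.
  rewrite mpartial_mul; [|exact: Ckmx_tr (Ckmx_diff_mx 1)|exact: Ckmx_diff_mx].
  by rewrite mpartial_tr mpartial_U.
apply/matrixP => i j; rewrite [LHS]mxE [RHS]mxE metric_entry.
have dc : derivable (fun=> (i == j)%:R : R) x (basis_vec k) by exact: derivable_cst.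
by rewrite (partialD dc (Ck_derivable (CUU 1 i j) k x)) partial_cst add0r.
Qed.

Definition ln_det x : R := ln (\det (metric u x)).

Lemma Ck_ln_det l : Ck l ln_det.
Proof. by apply: Ck_ln; [exact: det_metric_gt0|exact: Ck_det (Ckmx_metric l)]. Qed.

Lemma partial_ln_det_metric k x : partial k ln_det x = 2 * \tr (T x *m B k x).
Proof.
rewrite (partial_ln_det k x det_metric_gt0 (Ckmx_metric 1)) mpartial_metric.
rewrite -/(gi x) mulmxDr mxtraceD.
have -> : \tr (gi x *m ((B k x)^T *m U x)) = \tr (gi x *m ((U x)^T *m B k x)).
  rewrite -mxtrace_tr !trmx_mul trmxK giE inv_metric_sym mulmxA -mulmxA.
  by rewrite mxtrace_mulC -!mulmxA mxtrace_mulC -!mulmxA.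
by rewrite /T !mulmxA mulr_natl.
Qed.

Lemma mpartial_inv_metric k x : mpartial k gi x =
  - (gi x *m ((B k x)^T *m U x + (U x)^T *m B k x) *m gi x).
Proof.
by rewrite (mpartial_inv k x det_metric_neq0 (Ckmx_metric 1)) mpartial_metric.
Qed.

Let CT l : Ckmx l T.
Proof. by apply: Ckmx_mul (Ckmx_inv_metric l) (Ckmx_tr (Ckmx_diff_mx l)). Qed.

Let mpartial_T k x : mpartial k T x =
  gi x *m (B k x)^T *m (1%:M - U x *m T x) - T x *m B k x *m T x.
Proof.
rewrite (mpartial_mul k x (Ckmx_inv_metric 1) (Ckmx_tr (Ckmx_diff_mx 1))).
rewrite mpartial_tr mpartial_U mpartial_inv_metric /T.
rewrite mulmxDr mulNmx 2!mulmxDl opprD mulmxBr mulmx1 !mulmxA.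
have rot (X Y Z : 'M[R]_(n, m)) : - X - Y + Z = Z - X - Y by rewrite addrC addrA.
exact: rot.
Qed.

Lemma partial2_ln_det_metric i j x : partial i (partial j ln_det) x =
  2 * (\tr (gi x *m (B i x)^T *m (1%:M - U x *m T x) *m B j x)
       - \tr (T x *m B i x *m (T x *m B j x)) + \tr (T x *m mpartial i (B j) x)).
Proof.
rewrite (_ : partial j ln_det = fun y => 2 * \tr (T y *m B j y)); last first.
  by apply/funext => y; exact: partial_ln_det_metric.
have CTB := Ckmx_mul (CT 1) (Ckmx_hess_slice 1 j).
rewrite (partialZ _ (Ck_derivable (Ck_mxtrace CTB) i x)) (partial_mxtrace i x CTB).
rewrite (mpartial_mul i x (CT 1) (Ckmx_hess_slice 1 j)) mpartial_T.
rewrite mxtraceD mulmxBl [\tr (_ - _)]linearB /= -!mulmxA; congr (_ * _).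
Qed.

Hypothesis u_shrinker : self_shrinking_system u.

(** This is L applied to the derivative of u^a in direction p. Differentiating the right side of the
    system, the term from -u^a cancels the one from the coefficient x, leaving just the drift; the
    derivative of g^{ij} moves to the other side. *)
Let third_order_trace x a p :
  \sum_i \sum_j gi x i j * mpartial i (B j) x a p - \sum_i x 0 i * B i x a p
  = \sum_i \sum_j (gi x *m ((B p x)^T *m U x + (U x)^T *m B p x) *m gi x) i j
      * hessian x a i j.
Proof.
pose lhs y := \sum_i \sum_j gi y i j * d2 u a i j y.
pose rhs y := -1 * component u a y + \sum_i y 0 i * partial i (component u a) y.
have E : lhs = rhs.
  by apply/funext => y; rewrite /lhs /rhs (u_shrinker y a) mulN1r.
have Cu l := u_smooth l a.
have Cd2 i j : Ck 1 (d2 u a i j) by exact: Ck_partial (Ck_partial (Cu 3) j) i.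
have DL : partial p lhs x = \sum_i \sum_j
   ((mpartial p gi x) i j * hessian x a i j + gi x i j * mpartial i (B j) x a p).
  rewrite partial_sum => [|i]; last first.
    by apply: Ck_sum => j; apply: CkM => //; exact: Ckmx_inv_metric.
  apply: eq_bigr => i _; rewrite partial_sum => [|j]; last first.
    by apply: CkM => //; exact: Ckmx_inv_metric.
  apply: eq_bigr => j _.
  rewrite (partialM (Ck_derivable (Ckmx_inv_metric 1 i j) p x)
    (Ck_derivable (Cd2 i j) p x)).
  rewrite [mpartial p gi x i j]mxE [mpartial i (B j) x a p]mxE; congr (_ + _ * _).
  rewrite /d2 (schwarz x p i (Ck_partial (Cu 3) j)); congr partial.
  by apply/funext => y; rewrite mxE; exact: (schwarz y p j (Cu 2)).
have DR : partial p rhs x = \sum_i x 0 i * B i x a p.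
  have C1 i : Ck 1 (partial i (component u a)) by exact: Ck_partial (Cu 2) i.
  have CS i : Ck 1 (fun y : 'rV[R]_n => y 0 i * partial i (component u a) y).
    by apply: CkM => //; exact: Ck_coord.
  rewrite (partialD (Ck_derivable (CkZ (-1) (Cu 1)) p x)
    (Ck_derivable (Ck_sum _ _ CS) p x)).
  rewrite (partialZ _ (Ck_derivable (Cu 1) p x)) partial_sum//.
  have -> : \sum_i partial p (fun y => y 0 i * partial i (component u a) y) x
     = \sum_i (i == p)%:R * partial i (component u a) x
       + \sum_i x 0 i * B i x a p.
    rewrite -big_split; apply: eq_bigr => i _.
    rewrite (partialM (Ck_derivable (Ck_coord 1 i) p x) (Ck_derivable (C1 i) p x)).
    rewrite partial_coord; congr (_ + _ * _).
    by rewrite mxE /hessian /d2; exact: schwarz x p i (Cu 2).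
  rewrite (bigD1 p)//= eqxx mul1r big1 ?addr0 => [|i /negbTE->]; last by rewrite mul0r.
  by rewrite addrA mulN1r addNr add0r.
have : partial p lhs x = partial p rhs x by rewrite E.
rewrite DL DR => {}E; rewrite -E.
have -> : \sum_i \sum_j ((mpartial p gi x) i j * hessian x a i j
    + gi x i j * mpartial i (B j) x a p)
   = \sum_i \sum_j (mpartial p gi x) i j * hessian x a i j
     + \sum_i \sum_j gi x i j * mpartial i (B j) x a p.
  by rewrite -big_split; apply: eq_bigr => i _; rewrite -big_split.
rewrite opprD addrCA subrr addr0 mpartial_inv_metric -sumrN.
have oppE (M : 'M[R]_n) i j : (- M) i j = - M i j by rewrite mxE.
apply: eq_bigr => i _; rewrite -sumrN; apply: eq_bigr => j _.
by rewrite oppE mulNr opprK.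
Qed.

(** The second derivatives of ln det g carry the cross term with sign -1; the third derivatives of
    u, eliminated through the system, add it back twice. *)
Lemma drift_op_ln_det x : drift_op gi ln_det x =
  2 * (form_sqnorm (U x) (hessian x) + form_cross (U x) (hessian x)).
Proof.
pose TB i := \tr (T x *m B i x); pose TD i j := \tr (T x *m mpartial i (B j) x).
rewrite /drift_op (@eq_jet_op _ _ _ _ _ _ (fun i j => 2 *
  (\tr (gi x *m (B i x)^T *m (1%:M - U x *m T x) *m B j x)
   - \tr (T x *m B i x *m (T x *m B j x)) + TD i j)) (fun i => 2 * TB i)); first last.
- by move=> i; exact: partial_ln_det_metric.
- by move=> i j; exact: partial2_ln_det_metric.
rewrite jet_opZ; congr (_ * _).
have -> : jet_op (gi x) x (fun i j =>
    \tr (gi x *m (B i x)^T *m (1%:M - U x *m T x) *m B j x)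
    - \tr (T x *m B i x *m (T x *m B j x)) + TD i j) TB =
  form_sqnorm (U x) (hessian x) - form_cross (U x) (hessian x) +
  (\sum_i \sum_j gi x i j * TD i j - \sum_i x 0 i * TB i).
  rewrite /jet_op /form_sqnorm /form_cross -!giE addrA; congr (_ - _).
  rewrite -sumrB -big_split /=; apply: eq_bigr => i _.
  rewrite -sumrB -big_split /=; apply: eq_bigr => j _.
  by rewrite -mulrBr -mulrDr.
have -> : \sum_i \sum_j gi x i j * TD i j - \sum_i x 0 i * TB i =
    2 * form_cross (U x) (hessian x).
  rewrite -form_cross_third; last by move=> a i j; exact: hessian_sym.
  rewrite -giE -/(T x).
  transitivity (\sum_p \sum_a T x p a *
    (\sum_i \sum_j gi x i j * mpartial i (B j) x a p - \sum_i x 0 i * B i x a p)).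
    under [RHS]eq_bigr do under eq_bigr do rewrite mulrBr.
    under [RHS]eq_bigr do rewrite sumrB.
    rewrite sumrB; congr (_ - _).
      rewrite /TD /mxtrace; under eq_bigr do under eq_bigr do rewrite mulr_sumr.
      rewrite exchange_sum3; apply: eq_bigr => p _.
      under eq_bigr do under eq_bigr do rewrite [(_ *m _) p p]mxE mulr_sumr.
      rewrite exchange_sum3; apply: eq_bigr => a _; rewrite mulr_sumr.
      by apply: eq_bigr => i _; rewrite mulr_sumr; apply: eq_bigr => j _; rewrite mulrCA.
    rewrite /TB /mxtrace; under eq_bigr do rewrite mulr_sumr.
    rewrite exchange_big; apply: eq_bigr => p _.
    under eq_bigr do rewrite [(_ *m _) p p]mxE mulr_sumr.
    rewrite exchange_big; apply: eq_bigr => a _; rewrite mulr_sumr.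
    by apply: eq_bigr => i _; rewrite mulrCA.
  apply: eq_bigr => p _; apply: eq_bigr => a _.
  by rewrite third_order_trace.
by move: (form_sqnorm (U x) (hessian x)) (form_cross (U x) (hessian x)) => c d; ring.
Qed.

Lemma grad_sq_ln_det x :
  \sum_i \sum_j gi x i j * (partial i ln_det x * partial j ln_det x)
  = 4 * form_grad (U x) (hessian x).
Proof.
have -> : form_grad (U x) (hessian x) = \sum_i \sum_j
    gi x i j * (\tr (T x *m B i x) * \tr (T x *m B j x)) by rewrite /form_grad -giE.
rewrite mulr_sumr; apply: eq_bigr => i _; rewrite mulr_sumr; apply: eq_bigr => j _.
rewrite !partial_ln_det_metric.
have shuffle (c d e : R) : e * (2 * c * (2 * d)) = 4 * (e * (c * d)) by ring.
exact: shuffle.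
Qed.

Lemma drift_op_exp_ln_det (k : R) x :
  drift_op gi (fun y => expR (k * ln_det y)) x = expR (k * ln_det x) * (2 * k *
   (form_sqnorm (U x) (hessian x) + form_cross (U x) (hessian x)
    + 2 * k * form_grad (U x) (hessian x))).
Proof.
have CL := Ck_ln_det 2.
rewrite (drift_op_expR _ _ (CkZ k CL)) (drift_opZ _ _ _ CL) drift_op_ln_det.
have -> : \sum_i \sum_j gi x i j *
    (partial i (fun y => k * ln_det y) x * partial j (fun y => k * ln_det y) x)
    = k ^+ 2 * (4 * form_grad (U x) (hessian x)).
  rewrite -grad_sq_ln_det mulr_sumr; apply: eq_bigr => i _.
  rewrite mulr_sumr; apply: eq_bigr => j _.
  rewrite !(partialZ _ (Ck_derivable CL _ x)).
  have shuffle (c d e : R) : e * (k * c * (k * d)) = k ^+ 2 * (e * (c * d)) by ring.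
  exact: shuffle.
by move: (form_sqnorm (U x) (hessian x)) (form_cross (U x) (hessian x))
  (form_grad (U x) (hessian x)) => b c d; ring.
Qed.

(** The sign condition on [c * k] makes c (det g)^k superharmonic; the factor c allows both a
    negative exponent with c = 1 and k = 1 with c = -1. *)
Lemma hessian_eq0 (k c C : R) :
  (forall x, positive_form (U x) (hessian x) (2 * k)) -> c * k < 0 ->
  (forall x, C <= c * expR (k * ln_det x)) ->
  forall x a i j, d2 u a i j x = 0.
Proof.
move=> pos ck C_le.
pose w x := c * expR (k * ln_det x).
have CE : Ck 2 (fun y => expR (k * ln_det y)) by exact: (Ck_expR (CkZ k (Ck_ln_det 2))).
have Cw : Ck 2 w by exact: (CkZ c CE).
have Lw x : drift_op gi w x = c * k * (expR (k * ln_det x) * (2 *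
    (form_sqnorm (U x) (hessian x) + form_cross (U x) (hessian x)
    + 2 * k * form_grad (U x) (hessian x)))).
  rewrite (drift_opZ _ _ _ CE) drift_op_exp_ln_det.
  by move: (expR (k * ln_det x)) (form_sqnorm (U x) (hessian x))
    (form_cross (U x) (hessian x)) (form_grad (U x) (hessian x)) => e b f d; ring.
have w_super x : drift_op gi w x <= 0.
  rewrite Lw; have [Q0 _] := pos x; apply: mulr_le0_ge0; first exact: ltW.
  by apply: mulr_ge0; [exact: expR_ge0|apply: mulr_ge0].
have cont i j : continuous (fun y => gi y i j).
  exact: (Ck_continuous (Ckmx_inv_metric 0 i j)).
have [p wp] := superharmonic_constant inv_metric_positive inv_metric_diag cont
  Cw C_le w_super.
move=> x; have [_ Q0] := pos x; apply: Q0.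
have : drift_op gi w x = 0 := drift_op_cst gi x wp.
rewrite Lw => /eqP; rewrite mulf_eq0 lt_eqF//= mulf_eq0 gt_eqF ?expR_gt0//=.
by rewrite mulf_eq0 pnatr_eq0 /= => /eqP ->.
Qed.

Lemma graph_linear : (forall x a i j, d2 u a i j x = 0) ->
  exists V : {vspace 'rV[R]_(n + m)}, graph_of u = [set v | v \in V].
Proof.
move=> H0.
have dcst a i x : d1 u a i x = d1 u a i 0.
  have C1 : Ck 1 (partial i (component u a)) by exact: Ck_partial (u_smooth 2 a) i.
  have [c _] := mvt_line 0 1 (fun y => (Ck1_derive y x C1).1).
  rewrite (Ck1_derive _ _ C1).2 big1 => [|j _].
    by rewrite mulr0 scale1r add0r => /eqP; rewrite subr_eq0 => /eqP.
  by rewrite -[partial j _ _]/(d2 u a j i _) H0 mulr0.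
pose M : 'M[R]_(n, m) := (diff_mx u 0)^T.
(* With zero left side the system is Euler's relation u = x . Du, which leaves no constant term. *)
have uM x : u x = x *m M.
  apply/rowP => a; have := u_shrinker x a.
  rewrite big1 => [|i _]; last by rewrite big1// => j _; rewrite H0 mulr0.
  move=> /esym/eqP; rewrite addrC subr_eq0 => /eqP <-.
  by rewrite mxE; apply: eq_bigr => i _; rewrite !mxE dcst.
pose F : 'Hom('rV[R]_n, 'rV[R]_(n + m)) :=
  linfun (mulmxr (row_mx 1%:M M : 'M[R]_(n, n + m))).
have FE x : F x = row_mx x (u x) by rewrite lfunE /= mul_mx_row mulmx1 uM.
exists (limg F); apply/seteqP; split => v /=.
  by move=> [x _ <-]; rewrite -FE memv_img// memvf.
by move=> /memv_imgP[x _ ->]; exists x => //; rewrite FE.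
Qed.

End SmoothGraph.

Theorem theorem10 (R : realType) (n m : nat) (hn : (1 <= n)%N) (hm : (1 <= m)%N)
    (u : 'rV[R]_n -> 'rV[R]_m)
    (u_smooth : smooth_map u)
    (u_shrinker : self_shrinking_system u)
    (assumption :
      (* (i) *)
      (forall (x : 'rV[R]_n) (lam : 'I_n -> R),
         singular_values (diff_mx u x) lam ->
         forall i j : 'I_n, i <> j -> lam i * lam j <= 1)
      \/
      (* (ii) *)
      (exists beta : R, 0 < beta /\ beta < 9 /\
         forall x : 'rV[R]_n, \det (metric u x) <= beta)
      \/
      (* (iii) *)
      (forall (x : 'rV[R]_n) (a b : 'I_m) (p q : 'I_n),
         \sum_(i < n) \sum_(j < n) d2 u a q i x * inv_metric u x i j * d2 u b j p x
         = \sum_(i < n) \sum_(j < n) d2 u b q i x * inv_metric u x i j * d2 u a j p x)) :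
  exists V : {vspace 'rV[R]_(n + m)}, graph_of u = [set v | v \in V].
Proof.
apply: (graph_linear u_smooth u_shrinker).
have hsym x a i j : hessian u x a i j = hessian u x a j i := hessian_sym u_smooth x a i j.
pose k : R := - (2 * n%:R)^-1.
have k2 : 2 * k = - n%:R^-1.
  by rewrite /k; field; rewrite pnatr_eq0 -lt0n.
have k0 : 1 * k < 0 by rewrite mul1r oppr_lt0 invr_gt0 mulr_gt0// ltr0n.
have low x : 0 <= 1 * expR (k * ln_det u x) by rewrite mul1r expR_ge0.
case: assumption => [le1|[[beta [b0 [b9 le_beta]]]|flat]].
- apply: (hessian_eq0 u_smooth u_shrinker _ k0 low) => x; rewrite k2.
  exact: (positive_form_contracting (hsym x) (le1 x)).
(* Here c = -1 and k = 1, so 2k is the coefficient 2 of [positive_form_small_det]. *)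
- have p1 : -1 * 1 < 0 :> R by rewrite mulr1 oppr_lt0 ltr01.
  have low' x : - beta <= -1 * expR (1 * ln_det u x).
    by rewrite mul1r mulN1r lerN2 lnK// posrE; exact: det_metric_gt0.
  apply: (hessian_eq0 u_smooth u_shrinker _ p1 low') => x; rewrite mulr1.
  apply: (positive_form_small_det (hsym x)).
  by rewrite -metricE; apply: le_lt_trans b9; exact: le_beta.
- apply: (hessian_eq0 u_smooth u_shrinker _ k0 low) => x; rewrite k2.
  apply: (positive_form_flat (hsym x)) => a b p q.
  by rewrite -metricE; exact: flat.
Qed.
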